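(* Let $\Omega$ be a domain in $\mathbb{R}^2$, let $\phi_1,\phi_2\colon S^1\to\Omega$ be two Lipschitz embeddings of $S^1$, and let $s=1$. If $[\phi_1]=[\phi_2]$ (as elements of $H^{-1}\Lambda^1(\Omega)$), then the curves $\phi_1$ and $\phi_2$ represent the same oriented shape.
   Context: A Lipschitz immersion is a curve $\phi\colon S^1\to\Omega$ whose components are Lipschitz and whose tangent vector $\phi'$, wherever it is defined (which is almost everywhere), is nonzero. A Lipschitz embedding is a Lipschitz immersion that is a homeomorphism onto its image. $H^1\Lambda^1(\Omega)$ is the Hilbert space of 1-forms $\alpha=\alpha_1\,dx_1+\alpha_2\,dx_2$ with coefficients in $H^1(\Omega)$, with inner product $\int_\Omega\big(\sum_i\alpha_i\beta_i+\sigma^2\sum_{i,j}\partial_{x_j}\alpha_i\,\partial_{x_j}\beta_i\big)\,dx_1dx_2$ for a fixed scale parameter $\sigma>0$; $H^{-1}\Lambda^1(\Omega)$ is its dual. The current of $\phi=(\phi^1,\phi^2)$ is the functional $[\phi](\alpha)=\int_{S^1}\phi^*\alpha=\int_{S^1}\big(\alpha_1(\phi(t))(\phi^1)'(t)+\alpha_2(\phi(t))(\phi^2)'(t)\big)\,dt$, restrictions of Sobolev coefficients to the curve being understood in the sense of traces; it belongs to $H^{-1}\Lambda^1(\Omega)$. Two curves represent the same oriented shape if they differ by an orientation-preserving reparameterization of $S^1$, i.e. (at the Lipschitz regularity considered) there is an orientation-preserving homeomorphism $\psi$ of $S^1$ with $\phi_2=\phi_1\circ\psi$; for embeddings this means that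 they have the same image, traversed in the same direction. *)

(* Defs.v *)
From HB Require Import structures.
From mathcomp Require Import all_boot all_order all_algebra.
From mathcomp Require Import all_classical all_reals all_analysis.

Set Implicit Arguments.
Unset Strict Implicit.
Unset Printing Implicit Defensive.

Import Order.TTheory GRing.Theory Num.Theory.
Import numFieldNormedType.Exports.

Local Open Scope classical_set_scope.
Local Open Scope ring_scope.

Notation lebesgue2 R :=
  (@lebesgue_measure R \x @lebesgue_measure R)%E (only parsing).

Definition domain (R : realType) (Omega : set (R * R)) : Prop :=
  [/\ open Omega, connected Omega & Omega !=set0].

Fixpoint Ck (R : realType) (k : nat) (f : R * R -> R) : Prop :=
  if k is k'.+1
  then (forall x v, derivable f x v) /\ (forall v, Ck k' (fun x => 'D_v f x))
  else continuous f.

Definition test_function (R : realType) (Omega : set (R * R))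
    (eta : R * R -> R) : Prop :=
  [/\ forall k, Ck k eta,
      compact (closure [set x | eta x != 0]) &
      closure [set x | eta x != 0] `<=` Omega].

(* Elements of L^2, H^1 and H^1Lambda^1 are represented by functions, equality
   almost everywhere being left implicit: the functionals in H^{-1}Lambda^1
   below are bounded by the H^1 norm, hence do not separate representatives. *)
Definition L2 (R : realType) (Omega : set (R * R)) (u : R * R -> R) : Prop :=
  measurable_fun Omega u /\
  (lebesgue2 R).-integrable Omega (fun x => (u x ^+ 2)%:E).

Definition is_weak_derive (R : realType) (Omega : set (R * R)) (v : R * R)
    (u g : R * R -> R) : Prop :=
  L2 Omega g /\
  forall eta, test_function Omega eta ->
    \int[lebesgue2 R]_(x in Omega) (u x * 'D_v eta x) =
    - \int[lebesgue2 R]_(x in Omega) (g x * eta x).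

Definition dx1 (R : realType) : R * R := (1, 0).
Definition dx2 (R : realType) : R * R := (0, 1).

Definition H1 (R : realType) (Omega : set (R * R)) (u : R * R -> R) : Prop :=
  [/\ L2 Omega u,
      exists g, is_weak_derive Omega (dx1 R) u g &
      exists g, is_weak_derive Omega (dx2 R) u g].

(* A choice of the weak derivative along v, which is unique up to null sets;
   the zero function if there is none. *)
Definition weak_derive (R : realType) (Omega : set (R * R)) (v : R * R)
    (u : R * R -> R) : R * R -> R :=
  xget (fun=> 0) [set g | is_weak_derive Omega v u g].

(* The 1-form alpha_1 dx_1 + alpha_2 dx_2 is encoded by x |-> (alpha_1 x,
   alpha_2 x). *)
Definition H1Lambda1 (R : realType) (Omega : set (R * R))
    (alpha : R * R -> R * R) : Prop :=
  H1 Omega (fst \o alpha) /\ H1 Omega (snd \o alpha).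

Definition grad_dot (R : realType) (Omega : set (R * R))
    (u w : R * R -> R) (x : R * R) : R :=
  weak_derive Omega (dx1 R) u x * weak_derive Omega (dx1 R) w x +
  weak_derive Omega (dx2 R) u x * weak_derive Omega (dx2 R) w x.

Definition H1Lambda1_dot (R : realType) (sigma : R) (Omega : set (R * R))
    (alpha beta : R * R -> R * R) : R :=
  \int[lebesgue2 R]_(x in Omega)
    ((alpha x).1 * (beta x).1 + (alpha x).2 * (beta x).2 +
     sigma ^+ 2 * (grad_dot Omega (fst \o alpha) (fst \o beta) x +
                   grad_dot Omega (snd \o alpha) (snd \o beta) x)).

(* Only the values on H^1Lambda^1 matter; see Hm1Lambda1_eq. *)
Definition Hm1Lambda1 (R : realType) (sigma : R) (Omega : set (R * R))
    (T : (R * R -> R * R) -> R) : Prop :=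
  (forall (a : R) (alpha beta : R * R -> R * R),
      H1Lambda1 Omega alpha -> H1Lambda1 Omega beta ->
      T (fun x => a *: alpha x + beta x) = a * T alpha + T beta) /\
  (exists C : R, forall alpha, H1Lambda1 Omega alpha ->
      `|T alpha| <= C * Num.sqrt (H1Lambda1_dot sigma Omega alpha alpha)).

Definition Hm1Lambda1_eq (R : realType) (Omega : set (R * R))
    (T1 T2 : (R * R -> R * R) -> R) : Prop :=
  forall alpha, H1Lambda1 Omega alpha -> T1 alpha = T2 alpha.

(* Curves S^1 -> R^2 are functions on the plane of which only the values on the
   unit circle matter; t |-> phi (circ t) is the curve in the angle t. *)
Definition S1 (R : realType) : set (R * R) :=
  [set z | z.1 ^+ 2 + z.2 ^+ 2 = 1].
Arguments S1 R : clear implicits.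

Definition circ (R : realType) (t : R) : R * R := (cos t, sin t).

Definition velocity (R : realType) (phi : R * R -> R * R) (t : R) : R * R :=
  derive1 (fun s => phi (circ s)) t.

Definition homeomorphism (T U : topologicalType) (A : set T) (B : set U)
    (f : T -> U) : Prop :=
  [/\ set_bij A B f, {within A, continuous f} &
      exists g : U -> T,
        (forall x, A x -> g (f x) = x) /\ {within B, continuous g}].

Definition lipschitz_immersion (R : realType) (Omega : set (R * R))
    (phi : R * R -> R * R) : Prop :=
  [/\ phi @` S1 R `<=` Omega,
      exists k : R, k.-lipschitz_(S1 R) (fst \o phi),
      exists k : R, k.-lipschitz_(S1 R) (snd \o phi) &
      forall t : R, derivable (fun s => phi (circ s)) t 1 ->
        velocity phi t != 0].

Definition lipschitz_embedding (R : realType) (Omega : set (R * R))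
    (phi : R * R -> R * R) : Prop :=
  lipschitz_immersion Omega phi /\
  homeomorphism (S1 R) (phi @` S1 R) phi.

Definition line_integral (R : realType) (phi alpha : R * R -> R * R) : R :=
  \int[@lebesgue_measure R]_(t in `[0, 2 * pi])
    ((alpha (phi (circ t))).1 * (velocity phi t).1 +
     (alpha (phi (circ t))).2 * (velocity phi t).2).

(* A form of class H^1 that is continuous on Omega is restricted to the curve
   pointwise.  Such forms are dense in H^1Lambda^1, so that restriction in the
   sense of traces amounts to extending line_integral phi from them by
   continuity for the H^1 norm. *)
Definition is_current (R : realType) (sigma : R) (Omega : set (R * R))
    (phi : R * R -> R * R) (T : (R * R -> R * R) -> R) : Prop :=
  Hm1Lambda1 sigma Omega T /\
  forall alpha, H1Lambda1 Omega alpha -> {within Omega, continuous alpha} ->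
    T alpha = line_integral phi alpha.

(* By density is_current determines the current on H^1Lambda^1.  The default
   value of xget makes current total; it is irrelevant for Lipschitz
   embeddings, whose current belongs to H^{-1}Lambda^1. *)
Definition current (R : realType) (sigma : R) (Omega : set (R * R))
    (phi : R * R -> R * R) : (R * R -> R * R) -> R :=
  xget (line_integral phi) [set T | is_current sigma Omega phi T].

(* Orientation is preserved when the homeomorphism moves the angle by an
   increasing lift to the universal cover circ : R -> S^1. *)
Definition orientation_preserving_homeo (R : realType)
    (psi : R * R -> R * R) : Prop :=
  homeomorphism (S1 R) (S1 R) psi /\
  exists theta : R -> R,
    [/\ continuous theta, {homo theta : s t / s < t} &
        forall t, psi (circ t) = circ (theta t)].

Definition same_oriented_shape (R : realType)
    (phi1 phi2 : R * R -> R * R) : Prop :=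
  exists2 psi : R * R -> R * R, orientation_preserving_homeo psi &
    forall z, S1 R z -> phi2 z = phi1 (psi z).

(* Main.v *)
(* The current of a Lipschitz curve, tested against the forms u dx_i with u
   continuous, is the vector measure obtained by pushing gamma' dt forward along
   gamma = phi o circ; comparing the two currents on such forms suffices, so that
   traces play no role.  Products of compactly supported C^1
   functions of x_1 and x_2 belong to H^1 and approximate the indicators of
   rectangles, so equal currents give the same measure to every Borel set.  On
   an arc gamma([a, b]) of an embedded curve this measure is
   gamma b - gamma a, because a Lipschitz function is the integral of its almost
   everywhere defined derivative.  Hence an arc of one curve that avoids the
   other one would have equal end points, so both curves have the same image,
   and phi2 = phi1 o psi with psi a homeomorphism of the circle.  If a lift of
   psi to the line were decreasing somewhere, some common arc would be traversed
   in opposite directions, so that gamma b - gamma a = gamma a - gamma b, which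
   contradicts injectivity again. *)
From HB Require Import structures.
Require Import Defs.
From mathcomp Require Import all_boot all_order all_algebra.
From mathcomp Require Import all_classical all_reals all_analysis.
From mathcomp Require Import measurable_realfun ring lra.

Set Implicit Arguments.
Unset Strict Implicit.
Unset Printing Implicit Defensive.

Import Order.TTheory GRing.Theory Num.Theory.
Import numFieldNormedType.Exports.

Local Open Scope classical_set_scope.
Local Open Scope ring_scope.

(** * Lipschitz functions on the line *)

Lemma lebesgue_stieltjes_itvoc (R : realType) (F : cumulative R R) (a b : R) :
  a <= b -> lebesgue_stieltjes_measure F `]a, b]%classic = (F b - F a)%:E.
Proof.
move=> ab; rewrite /lebesgue_stieltjes_measure /measure_extension.
rewrite measurable_mu_extE/=; last exact: is_ocitv.
by rewrite wlength_itv_bnd.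
Qed.

(* L x - F x is nondecreasing too, and the Stieltjes measures of F and of
   L x - F x add up to L times the Lebesgue measure. *)
Lemma increments_null_dominates (R : realType) (L : R) (F : cumulative R R) :
  (forall x y, x <= y -> F y - F x <= L * (y - x)) ->
  lebesgue_stieltjes_measure F `<< @lebesgue_measure R.
Proof.
move=> FL.
have L0 : 0 <= L.
  have := FL 0 1 ler01; rewrite subr0 mulr1; apply: le_trans.
  by rewrite subr_ge0; exact: cumulative_is_nondecreasing.
pose H x := L * x - F x.
have Hnd : {homo H : x y / x <= y}.
  by move=> x y xy; rewrite /H; have := FL _ _ xy; lra.
have Hrc : right_continuous H.
  move=> x; apply: cvgB; last exact: cumulative_is_right_continuous.
  by apply: right_continuousW => z; apply: cvgM; [exact: cvg_cst|exact: cvg_id].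
pose H' : cumulative R R := HB.pack H (isCumulative.Build R _ R H Hnd Hrc).
pose G x := L * x.
have Gnd : {homo G : x y / x <= y}.
  by move=> x y xy; rewrite /G ler_wpM2l.
have Grc : right_continuous G.
  by apply: right_continuousW => z; apply: cvgM; [exact: cvg_cst|exact: cvg_id].
pose G' : cumulative R R := HB.pack G (isCumulative.Build R _ R G Gnd Grc).
have e1 A : measurable A -> lebesgue_stieltjes_measure G' A =
    measure_add (lebesgue_stieltjes_measure F) (lebesgue_stieltjes_measure H') A.
  apply: (@lebesgue_stieltjes_measure_unique _ _ (measure_add _ _)).
  move=> X /ocitvP[->|[[a b]/= /ltW ab ->]]; first by rewrite !measure0.
  rewrite [RHS]measure_addE (lebesgue_stieltjes_itvoc G' ab).
  transitivity ((F b - F a)%:E + (H' b - H' a)%:E)%E.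
    by rewrite -EFinD /= /G /H; congr EFin; ring.
  by congr (_ + _)%E; symmetry; exact: lebesgue_stieltjes_itvoc.
have e2 A : measurable A -> lebesgue_stieltjes_measure G' A =
    mscale (NngNum L0) (@lebesgue_measure R) A.
  apply: (@lebesgue_stieltjes_measure_unique _ _ (mscale _ _)).
  move=> X /ocitvP[->|[[a b]/= /ltW ab ->]]; first by rewrite !measure0.
  rewrite /mscale/= (lebesgue_stieltjes_itvoc G' ab).
  transitivity (L%:E * (b - a)%:E)%E.
    by rewrite -EFinM /= /G; congr EFin; ring.
  by congr (_ * _)%E; symmetry; exact: lebesgue_stieltjes_itvoc.
move=> A nA B mB BA.
have := nA B mB BA => B0.
have := e1 _ mB.
rewrite e2// [LHS]/mscale/= B0 mule0 measure_addE => /esym/eqP.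
by rewrite padde_eq0// => /andP[/eqP].
Qed.

Lemma lipschitz_continuous (R : realType) (f : R -> R) (L : R) :
  (forall x y, `|f x - f y| <= L * `|x - y|) -> continuous f.
Proof.
move=> fL x; have L0 : 0 <= L.
  have := fL 1 0; rewrite subr0 normr1 mulr1; apply: le_trans; exact: normr_ge0.
apply/cvgrPdist_le => e e0; near=> t.
apply: (le_trans (fL _ _)).
apply: (@le_trans _ _ ((L + 1) * `|x - t|)); first by rewrite ler_wpM2r// lerDl.
rewrite mulrC -ler_pdivlMr ?ltr_wpDl//.
near: t; move: (e / _) (divr_gt0 e0 (ltr_wpDl L0 (@ltr01 R))).
by apply: cvgr_dist_le; exact: cvg_id.
Unshelve. all: by end_near. Qed.

(* The density comes from the Radon-Nikodym derivative of the Stieltjes measure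
   of the nondecreasing function L x + f x. *)
Lemma lipschitz_ftc (R : realType) (L T : R) (f : R -> R) :
  (forall x y, `|f x - f y| <= L * `|x - y|) -> 0 < T ->
  exists v : R -> R,
   [/\ measurable_fun [set: measurableTypeR R] v,
      lebesgue_measure.-integrable `[0, T] (EFin \o v),
      forall a b, 0 <= a -> a <= b -> b <= T ->
        \int[lebesgue_measure]_(t in `[a, b]) v t = f b - f a &
      {ae lebesgue_measure, forall t, 0 < t < T ->
         is_derive t 1 f (v t)}].
Proof.
move=> fL T0.
have cf := lipschitz_continuous fL.
pose F x := L * x + f x.
have Fnd : {homo F : x y / x <= y}.
  move=> x y xy; rewrite /F; have := fL x y.
  rewrite (distrC x) (ger0_norm (_ : 0 <= y - x)) ?subr_ge0// ler_norml => /andP[_].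
  lra.
have cF : continuous F.
  move=> x; apply: cvgD; last exact: cf.
  by apply: cvgM; [exact: cvg_cst|exact: cvg_id].
have Frc : right_continuous F by exact: right_continuousW.
pose F' : cumulative R R := HB.pack F (isCumulative.Build R _ R F Fnd Frc).
pose m := lebesgue_stieltjes_measure F'.
have mdom : m `<< @lebesgue_measure R.
  apply: (@increments_null_dominates _ (2 * L)) => x y xy /=.
  rewrite /F; have := fL y x.
  rewrite (ger0_norm (_ : 0 <= y - x)) ?subr_ge0// ler_norml => /andP[_].
  lra.
(* The Stieltjes measure is cut down to a bounded interval containing [[0, T]], so that it is finite
   and Radon-Nikodym applies. *)
pose D : set (measurableTypeR R) := `]-1, T]%classic.
have mD : measurable D by exact: measurable_itv.
have DE a b : -1 <= a -> a <= b -> b <= T ->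
    D `&` `]a, b]%classic = `]a, b]%classic.
  move=> a0 ab bT; apply/setIidPr => x /=; rewrite !in_itv/= => /andP[ax xb].
  by apply/andP; split; [exact: le_lt_trans ax|exact: le_trans bT].
have mDoo : (m D < +oo)%E.
  rewrite /m /D lebesgue_stieltjes_itvoc ?ltry//.
  by rewrite (le_trans _ (ltW T0))// lerN10.
pose nu := mfrestr mD mDoo.
have nudom : charge_of_finite_measure nu `<< @lebesgue_measure R.
  move=> A nA B mB BA; rewrite /charge_of_finite_measure /nu /mfrestr /mrestr.
  apply: (mdom A nA); first exact: measurableI.
  by move=> x [/BA].
pose rn := Radon_Nikodym (charge_of_finite_measure nu) (@lebesgue_measure R).
have irn : lebesgue_measure.-integrable [set: R] rn by exact: Radon_Nikodym_integrable.
have frn x : rn x \is a fin_num by exact: Radon_Nikodym_fin_num.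
pose w : R -> R := fine \o rn.
have wE : EFin \o w = rn by apply/funext => x /=; rewrite fineK.
have mw : measurable_fun [set: measurableTypeR R] w.
  by apply/measurable_EFinP; rewrite wE; exact: measurable_int irn.
have iw : lebesgue_measure.-integrable setT (EFin \o w) by rewrite wE.
have intw a b : -1 <= a -> a <= b -> b <= T ->
    \int[lebesgue_measure]_(t in `]a, b]) w t = F b - F a.
  move=> a1 ab bT; rewrite /Rintegral.
  under eq_integral do rewrite -[(w _)%:E]/((EFin \o w) _) wE.
  rewrite -Radon_Nikodym_integral//= /charge_of_finite_measure /nu /mfrestr.
  by rewrite /mrestr setIC DE// /m lebesgue_stieltjes_itvoc.
have icst a b : lebesgue_measure.-integrable `[a, b] (EFin \o cst L).
  apply: continuous_compact_integrable; first exact: segment_compact.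
  by apply: continuous_subspaceT => x; exact: cvg_cst.
have iwL (i : interval R) a b : [set` i] `<=` `[a, b]%classic ->
    lebesgue_measure.-integrable [set` i] (EFin \o (fun x => w x - L)).
  move=> iab.
  have -> : EFin \o (fun x => w x - L) = ((EFin \o w) \- (EFin \o cst L))%E by [].
  apply: integrableB; first exact: measurable_itv.
    by apply: (integrableS _ _ _ iw).
  by apply: (integrableS _ _ _ (icst a b)).
(* [w] is the density of [L x + f x]; subtracting [L] leaves that of [f]. *)
exists (fun x => w x - L); split.
- by apply: measurable_funB.
- by apply: (@iwL _ 0 T).
- move=> a b a0 ab bT.
  have a1 : -1 <= a by rewrite (le_trans _ a0)// lerN10.
  rewrite -Rintegral_itv_obnd_cbnd; last by apply: (@iwL _ a b); exact: subset_itv_oc_cc.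
  rewrite RintegralB//; last 2 first.
  + exact: integrableS iw.
  + by apply: integrableS (icst a b) => //; apply: subset_itv_oc_cc.
  rewrite intw// Rintegral_cst//.
  have e : lebesgue_measure (`]a, b]%classic : set R) = (b - a)%:E.
    rewrite lebesgue_measure_itv/= lte_fin.
    move: ab; rewrite le_eqVlt => /predU1P[->|->]; last by rewrite EFinB.
    by rewrite ltxx subrr.
  rewrite [fine _](congr1 fine e) /F /=; ring.
- have locw : locally_integrable [set: R] w.
    by apply: open_integrable_locally => //; exact: openT.
  (* Almost every [t] is a Lebesgue point of [w], and there the primitive of [w] has derivative
     [w t]. *)
  have := lebesgue_differentiation locw.
  apply: filterS; first exact: (ae_filter_ringOfSetsType lebesgue_measure).
  move=> t wt /andP[t0 tT].
  have iwt : lebesgue_measure.-integrable `]-1, t + 1]%classic (EFin \o w).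
    by apply: (integrableS _ _ _ iw).
  have [] := @FTC1_lebesgue_pt _ w (BRight (-1)) t (t + 1) (ltac:(by rewrite ltrDl))
     iwt _ wt.
    by rewrite lte_fin (lt_trans _ t0)// ltrN10.
  set W := (fun y : R => _) => dW W't.
  (* Near [t] the primitive [W] is [F - F (-1)], so [f] is recovered by removing an affine
     function. *)
  have fW : {near t, (fun x => W x - (L * x - F (-1))) =1 f}.
    near=> x; rewrite /W intw//; first by rewrite /F; ring.
      by near: x; apply: lt_le_nbhsr; rewrite (lt_trans _ t0)// ltrN10.
    by near: x; exact: lt_le_nbhsl.
  apply: near_eq_is_derive fW _; rewrite -W't derive1E.
  have dL : is_derive t 1 (fun x => L * x - F (-1)) L.
    by apply: is_derive_eq; rewrite subr0 [_ *: _]mulr1.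
  by apply: is_deriveB; exact: derivableP.
Unshelve. all: by end_near. Qed.

(** * Forms of class H^1 with separated variables *)

(** An open set is the union of the rational squares it contains, and these are countably many. *)
Lemma open_measurable_plane (R : realType)
    (O : set (measurableTypeR R * measurableTypeR R)) :
  @open (R * R)%type O -> measurable O.
Proof.
move=> oO.
pose box (i : rat * rat * rat) : set (measurableTypeR R * measurableTypeR R) :=
  ball (ratr i.1.1 : R) (ratr i.2 : R) `*` ball (ratr i.1.2 : R) (ratr i.2 : R).
pose F i := if `[< box i `<=` O >] then box i else set0.
have -> : O = \bigcup_i F i.
  apply/seteqP; split => [x Ox|x [i _]]; last first.
    by rewrite /F; case: asboolP => // iO /iO.
  have /nbhs_ballP[e /= e0 eO] := open_nbhs_nbhs (conj oO Ox : open_nbhs (x : R * R) O).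
  (* With [r] below [e / 2], a square of radius [r] about a centre within [r] of [x] stays in the
     ball of radius [e] about [x]. *)
  have [r /andP[r0 re]] : exists r : rat, 0 < (ratr r : R) < e / 2.
    by have /rat_in_itvoo[r] := divr_gt0 e0 (@ltr0Sn R 1); exists r.
  have near_rat (y : R) : exists a : rat, ball (ratr a : R) (ratr r : R) y.
    have /rat_in_itvoo[a] : y < y + (ratr r : R) by rewrite ltrDl.
    rewrite in_itv/= => /andP[ya ay]; exists a; rewrite /ball/= ger0_norm; lra.
  have [a xa] := near_rat x.1; have [b xb] := near_rat x.2.
  exists (a, b, r) => //; rewrite /F asboolT//.
  move=> y [/= ya yb]; apply: eO.
  have tri (u v w : R) : ball v (ratr r : R) u -> ball v (ratr r : R) w -> ball u e w.
    rewrite /ball/= => vu vw; have -> : u - w = (v - w) - (v - u) by ring.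
    by apply: le_lt_trans (ler_normB _ _) _; lra.
  by split; [exact: tri xa ya|exact: tri xb yb].
apply: countable_bigcupT_measurable; first exact: countableP.
move=> i; rewrite /F.
by case: asboolP => // _; apply: measurableX; exact: measurable_ball.
Qed.

Lemma continuous_measurable_plane (R : realType) (f : R * R -> R) :
  continuous f ->
  measurable_fun [set: measurableTypeR R * measurableTypeR R] f.
Proof.
move=> cf.
apply: (measurability _ (RGenOpens.measurableE R)).
move=> _ [_ [a [b ->] <-]]; rewrite setTI.
apply: open_measurable_plane; move: cf => /continuousP; apply; exact: interval_open.
Qed.

Lemma compact_measurable_plane (R : realType)
    (K : set (measurableTypeR R * measurableTypeR R)) :
  @compact (R * R)%type K -> measurable K.
Proof.
move=> cK; rewrite -[K]setCK; apply: measurableC; apply: open_measurable_plane.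
rewrite openC; apply: compact_closed => //.
Qed.

Lemma pair_continuous (T U V : topologicalType) (f : T -> U) (g : T -> V) :
  continuous f -> continuous g -> continuous (fun t => (f t, g t)).
Proof. by move=> cf cg t; exact: cvg_pair (cf t) (cg t). Qed.

Lemma plane_integrable (R : realType) (M : R) (g : R * R -> R) :
  continuous g -> (forall x y, M < `|x| \/ M < `|y| -> g (x, y) = 0) ->
  (lebesgue2 R).-integrable setT (EFin \o g).
Proof.
move=> cg g0.
pose I : set (measurableTypeR R) := `[- M, M]%classic.
have mI : measurable I by exact: measurable_itv.
have -> : EFin \o g = (EFin \o g) \_ (I `*` I).
  apply/funext => -[x y]; rewrite patchE; case: ifPn => // /negP xy.
  rewrite /= g0//; apply: contrapT => /not_orP[/negP xM /negP yM]; apply: xy.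
  by rewrite inE; split; rewrite /I/= in_itv/= -ler_norml leNgt.
have mII : measurable (I `*` I) by exact: measurableX.
apply/(integrable_mkcond _ mII).
apply: measurable_bounded_integrable.
- exact: mII.
- rewrite [ltLHS](_ : _ = lebesgue_measure I * lebesgue_measure I)%E; last first.
    exact: product_measure1E.
  by rewrite lte_mul_pinfty// ?ge0_fin_numE// compact_finite_measure//; exact: segment_compact.
- by apply: measurable_funTS; exact: continuous_measurable_plane.
- have : compact (g @` (`[- M, M] `*` `[- M, M])).
    apply: continuous_compact; first exact: continuous_subspaceT.
    by apply: compact_setX; exact: segment_compact.
  move=> /compact_bounded[B [_ BP]]; exists B; split; rewrite ?num_real // => C BC z Iz.
  by apply: (BP C BC); exists z.
Qed.

(** The fundamental theorem of calculus on a segment whose end points lie outside the support. *)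
Lemma integral_derive_compact (R : realType) (M : R) (f f' : R -> R) :
  (forall x : R, is_derive x 1 f (f' x)) -> continuous f' ->
  (forall x, M < `|x| -> f x = 0) -> (forall x, M < `|x| -> f' x = 0) ->
  (\int[@lebesgue_measure R]_x (f' x)%:E)%E = 0%E.
Proof.
move=> df cf' f0 f'0.
(* [N] exceeds [M] and is positive even when [M] is negative. *)
pose N := `|M| + 1.
have N0 : 0 < N by rewrite /N ltr_wpDl.
have MN : M < N by rewrite /N (le_lt_trans (ler_norm M))// ltrDl.
have -> : (\int[@lebesgue_measure R]_x (f' x)%:E =
    \int[@lebesgue_measure R]_(x in `[(- N)%R, N]) (f' x)%:E)%E.
  rewrite [RHS]integral_mkcond; apply: eq_integral => x _.
  rewrite patchE; case: ifPn => // /negP xN; rewrite f'0//.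
  rewrite ltNge; apply/negP => xM; apply: xN.
  by rewrite inE/= in_itv/= -ler_norml (le_trans xM)// ltW.
have cf x : {for x, continuous f}.
  by apply: differentiable_continuous; apply/derivable1_diffP; have [] := df x.
rewrite (@continuous_FTC2 _ f' f).
- by rewrite !f0 ?subee// ?normrN gtr0_norm.
- by rewrite gtrN.
- exact: continuous_subspaceT.
- split.
  + by move=> x _; have [] := df x.
  + by apply: cvg_at_right_filter; exact: cf.
  + by apply: cvg_at_left_filter; exact: cf.
- by move=> x _; rewrite derive1E; have [_] := df x.
Qed.

(** By Fubini: for each [y] the inner integral in [x] is that of the derivative of a compactly
    supported function. *)
Lemma plane_integral_partial1 (R : realType) (M : R) (F h : R * R -> R) :
  (forall x y : R, is_derive x 1 (fun s => F (s, y)) (h (x, y))) -> continuous h ->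
  (forall x y, M < `|x| \/ M < `|y| -> F (x, y) = 0) ->
  (forall x y, M < `|x| \/ M < `|y| -> h (x, y) = 0) ->
  \int[lebesgue2 R]_z h z = 0.
Proof.
move=> dF ch F0 h0; rewrite /Rintegral.
rewrite -[X in fine X]integral21_prod_meas1; last exact: plane_integrable h0.
rewrite integral0_eq// => y _.
apply: (@integral_derive_compact _ M (fun s => F (s, y)) (fun s => h (s, y))) => //.
- move=> x; apply: (@continuous_comp _ _ _ (fun s => (s, y)) h); last exact: ch.
  by apply: pair_continuous => ?; [exact: cvg_id|exact: cvg_cst].
- by move=> x xM; apply: F0; left.
- by move=> x xM; apply: h0; left.
Qed.

Lemma plane_integral_partial2 (R : realType) (M : R) (F h : R * R -> R) :
  (forall x y : R, is_derive y 1 (fun s => F (x, s)) (h (x, y))) -> continuous h ->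
  (forall x y, M < `|x| \/ M < `|y| -> F (x, y) = 0) ->
  (forall x y, M < `|x| \/ M < `|y| -> h (x, y) = 0) ->
  \int[lebesgue2 R]_z h z = 0.
Proof.
move=> dF ch F0 h0; rewrite /Rintegral.
rewrite -[X in fine X]integral12_prod_meas1; last exact: plane_integrable h0.
rewrite integral0_eq// => x _.
apply: (@integral_derive_compact _ M (fun s => F (x, s)) (fun s => h (x, s))) => //.
- move=> y; apply: (@continuous_comp _ _ _ (fun s => (x, s)) h); last exact: ch.
  by apply: pair_continuous => ?; [exact: cvg_cst|exact: cvg_id].
- by move=> y yM; apply: F0; right.
- by move=> y yM; apply: h0; right.
Qed.

Lemma is_derive_slice1 (R : realType) (f : R * R -> R) (x y : R) :
  derivable f (x, y) (dx1 R) ->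
  is_derive x 1 (fun s => f (s, y)) ('D_(dx1 R) f (x, y)).
Proof.
move=> df.
have e : (fun h => h^-1 *: ((f \o shift (x, y)) (h *: dx1 R) - f (x, y))) =
    (fun h => h^-1 *: (((fun s => f (s, y)) \o shift x) (h *: 1) - f (x, y))).
  apply/funext => h /=; congr (_ *: (f _ - _)).
  by congr pair; rewrite /= scaler0 add0r.
by split; [rewrite /derivable -e|rewrite /derive -e].
Qed.

Lemma is_derive_slice2 (R : realType) (f : R * R -> R) (x y : R) :
  derivable f (x, y) (dx2 R) ->
  is_derive y 1 (fun s => f (x, s)) ('D_(dx2 R) f (x, y)).
Proof.
move=> df.
have e : (fun h => h^-1 *: ((f \o shift (x, y)) (h *: dx2 R) - f (x, y))) =
    (fun h => h^-1 *: (((fun s => f (x, s)) \o shift y) (h *: 1) - f (x, y))).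
  apply/funext => h /=; congr (_ *: (f _ - _)).
  by congr pair; rewrite /= scaler0 add0r.
by split; [rewrite /derivable -e|rewrite /derive -e].
Qed.

(** The constant [c] stands for the other tensor factor, frozen while one coordinate varies. *)
Lemma is_derive_mul_scaled (R : realType) (f g : R -> R) (x c f' g' : R) :
  is_derive x 1 f f' -> is_derive x 1 g g' ->
  is_derive x 1 (fun s => f s * c * g s) (f x * c * g' + f' * c * g x).
Proof.
move=> df dg.
have dfc : is_derive x 1 (fun s => f s * c) (f' * c).
  rewrite (_ : (fun s => f s * c) = c \*: f); last by apply/funext => s /=; rewrite mulrC.
  by apply: is_derive_eq; rewrite [_ *: _]mulrC.
have -> : (fun s => f s * c * g s) = (fun s => f s * c) * g by [].
by apply: is_derive_eq; rewrite /GRing.scale/=; ring.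
Qed.

(** The derivative is carried along as a function because the weak derivatives of a tensor product
    are written with it. *)
Definition compact_C1 (R : realType) (M : R) (a a' : R -> R) : Prop :=
  [/\ forall x : R, is_derive x 1 a (a' x), continuous a',
      forall x, M < `|x| -> a x = 0 &
      forall x, M < `|x| -> a' x = 0].

Lemma compact_C1_continuous (R : realType) (M : R) (a a' : R -> R) :
  compact_C1 M a a' -> continuous a.
Proof.
move=> [da _ _ _] x.
by apply: differentiable_continuous; apply/derivable1_diffP; have [] := da x.
Qed.

Lemma tensor_continuous (R : realType) (a b : R -> R) :
  continuous a -> continuous b -> continuous (fun z : R * R => a z.1 * b z.2).
Proof.
move=> ca cb z; apply: cvgM.
  by apply: continuous_comp; [exact: cvg_fst|exact: ca].
by apply: continuous_comp; [exact: cvg_snd|exact: cb].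
Qed.

Lemma L2_tensor (R : realType) (Omega : set (R * R)) (M : R) (a b : R -> R) :
  open Omega -> continuous a -> continuous b ->
  (forall x, M < `|x| -> a x = 0) -> (forall x, M < `|x| -> b x = 0) ->
  L2 Omega (fun z => a z.1 * b z.2).
Proof.
move=> oO ca cb a0 b0.
have cab := tensor_continuous ca cb.
have mO : measurable (Omega : set (measurableTypeR R * measurableTypeR R)).
  exact: open_measurable_plane.
split.
  have m : measurable_fun [set: measurableTypeR R * measurableTypeR R]
    (fun z : R * R => a z.1 * b z.2) by exact: continuous_measurable_plane.
  move=> _ Y mY.
  have := m measurableT Y mY; rewrite setTI => mpre.
  exact: (measurableI _ _ mO mpre).
apply: (@integrableS _ _ _ (lebesgue2 R) setT) => //.
apply: (@plane_integrable _ M).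
  by move=> z; apply: cvgM; exact: cab.
by move=> x y [xM|yM] /=; [rewrite (a0 _ xM) mul0r|rewrite (b0 _ yM) mulr0]; exact: mul0r.
Qed.

(** The complement of the support is open, so [eta] vanishes near [x] and its derivative vanishes
    with it. This lets integrals over [Omega] be taken over the whole plane. *)
Lemma test_function_notin (R : realType) (Omega : set (R * R)) v eta x :
  test_function Omega eta -> ~ Omega x -> eta x = 0 /\ 'D_v eta x = 0.
Proof.
move=> [_ _ sO] Ox.
have nx : ~ closure [set x | eta x != 0] x by move=> /sO.
have e : {near x, eta =1 cst 0}.
  have : nbhs x (~` closure [set x | eta x != 0]).
    apply: open_nbhs_nbhs; split=> //; apply: closed_openC; exact: closed_closure.
  apply: filterS => y ny; apply: contrapT => /eqP ey; apply: ny.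
  exact: subset_closure.
split; first exact: (nbhs_singleton e).
by rewrite (near_eq_derive _ e) derive_cst.
Qed.

(** Integration by parts is reduced to one vanishing integral over the plane, that of the derivative
    of [u eta]. Integrability comes from the compact support of [u] and [g]. *)
Lemma weak_derive_by_parts (R : realType) (Omega : set (R * R)) (M : R) v
    (u g : R * R -> R) :
  L2 Omega g -> continuous u -> continuous g ->
  (forall x y, M < `|x| \/ M < `|y| -> u (x, y) = 0) ->
  (forall x y, M < `|x| \/ M < `|y| -> g (x, y) = 0) ->
  (forall eta, continuous eta -> (forall x, derivable eta x v) ->
     continuous (fun x => 'D_v eta x) ->
     \int[lebesgue2 R]_z (u z * 'D_v eta z + g z * eta z) = 0) ->
  is_weak_derive Omega v u g.
Proof.
move=> L2g cu cg u0 g0 H; split=> // eta teta.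
have [Ceta _ _] := teta.
have ce := Ceta 0%N; have [de cde] := Ceta 1%N.
have {H} := H eta ce (fun x => de x v) (cde v).
have cont2 (f1 f2 : R * R -> R) : continuous f1 -> continuous f2 -> continuous (f1 \* f2).
  by move=> c1 c2 z; apply: cvgM; [exact: c1|exact: c2].
rewrite RintegralD//; last 2 first.
- apply: (@plane_integrable _ M (u \* (fun x => 'D_v eta x))).
    by apply: cont2 => //; exact: cde.
  by move=> x y xy /=; rewrite u0// mul0r.
- apply: (@plane_integrable _ M (g \* eta)); first exact: cont2.
  by move=> x y xy /=; rewrite g0// mul0r.
move/eqP; rewrite addr_eq0 => /eqP.
have restr (f1 f2 : R * R -> R) : (forall x, ~ Omega x -> f2 x = 0) ->
    \int[lebesgue2 R]_(x in Omega) (f1 x * f2 x) = \int[lebesgue2 R]_x (f1 x * f2 x).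
  move=> f0; rewrite Rintegral_mkcond; apply: eq_Rintegral => x _.
  by rewrite patchE; case: ifPn => // /negP xO; rewrite f0 ?mulr0// => /mem_set.
rewrite restr; last by move=> x /(test_function_notin v teta) [].
by rewrite restr// => x /(test_function_notin v teta) [].
Qed.

(** The weak partial derivatives are the classical ones, [a' b] and [a b']: the integrand to be
    cancelled is a partial derivative of [a b eta]. *)
Lemma H1_tensor (R : realType) (Omega : set (R * R)) (M : R) (a a' b b' : R -> R) :
  open Omega -> compact_C1 M a a' -> compact_C1 M b b' ->
  H1 Omega (fun z => a z.1 * b z.2).
Proof.
move=> oO Ca Cb.
have [ca cb] := (compact_C1_continuous Ca, compact_C1_continuous Cb).
have [da ca' a0 a'0] := Ca; have [db cb' b0 b'0] := Cb.
have van (f1 f2 : R -> R) : (forall x, M < `|x| -> f1 x = 0) ->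
    (forall x, M < `|x| -> f2 x = 0) ->
    forall x y, M < `|x| \/ M < `|y| -> f1 (x, y).1 * f2 (x, y).2 = 0.
  by move=> f10 f20 x y [xM|yM] /=; [rewrite (f10 _ xM) mul0r|rewrite (f20 _ yM) mulr0].
have cont2 (f1 f2 : R * R -> R) : continuous f1 -> continuous f2 -> continuous (f1 \* f2).
  by move=> c1 c2 z; apply: cvgM; [exact: c1|exact: c2].
have cD (f1 f2 : R * R -> R) : continuous f1 -> continuous f2 -> continuous (f1 \+ f2).
  by move=> c1 c2 z; apply: cvgD; [exact: c1|exact: c2].
split.
- exact: L2_tensor a0 b0.
- exists (fun z => a' z.1 * b z.2).
  apply: (@weak_derive_by_parts _ _ M).
  + exact: L2_tensor a'0 b0.
  + exact: tensor_continuous.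
  + exact: tensor_continuous.
  + exact: van.
  + exact: van.
  + move=> eta ce de cde.
    apply: (@plane_integral_partial1 _ M (fun z => a z.1 * b z.2 * eta z)).
    * move=> x y; have dex := is_derive_slice1 (de (x, y)).
      exact: (is_derive_mul_scaled (b y) (da x) dex).
    * by apply: cD; apply: cont2 => //; exact: tensor_continuous.
    * by move=> x y xy; rewrite van// mul0r.
    * by move=> x y xy; rewrite !van// !mul0r addr0.
- exists (fun z => a z.1 * b' z.2).
  apply: (@weak_derive_by_parts _ _ M).
  + exact: L2_tensor a0 b'0.
  + exact: tensor_continuous.
  + exact: tensor_continuous.
  + exact: van.
  + exact: van.
  + move=> eta ce de cde.
    apply: (@plane_integral_partial2 _ M (fun z => a z.1 * b z.2 * eta z)).
    * move=> x y; have dey := is_derive_slice2 (de (x, y)).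
      have -> : (fun s => a (x, s).1 * b (x, s).2 * eta (x, s)) =
          (fun s => b s * a x * eta (x, s)) by apply/funext => s; rewrite [a _ * _]mulrC.
      have := is_derive_mul_scaled (a x) (db y) dey.
      by rewrite (mulrC (b y)) (mulrC (b' y)).
    * by apply: cD; apply: cont2 => //; exact: tensor_continuous.
    * by move=> x y xy; rewrite van// mul0r.
    * by move=> x y xy; rewrite !van// !mul0r addr0.
Qed.

(** * C^1 approximations of indicators of intervals *)

Lemma is_derive_quadratic (R : realType) (f : R -> R) (x d : R) :
  (forall h, `|f (x + h) - f x - h * d| <= h ^+ 2) -> is_derive x 1 f d.
Proof.
move=> fd.
have cv : (fun h => h^-1 *: ((f \o shift x) (h *: 1) - f x)) @ 0^' --> d.
  apply/cvgrPdist_le => e e0; near=> h.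
  have h0 : h != 0 by near: h; exact: nbhs_dnbhs_neq.
  have he : `|h| <= e.
    near: h; exact: (dnbhs0_le e0).
  have -> : d - h^-1 *: ((f \o shift x) (h *: 1) - f x) =
      - h^-1 * (f (x + h) - f x - h * d).
    rewrite /= /GRing.scale/= mulr1 (addrC h x); field.
    by [].
  rewrite normrM normrN normfV ler_pdivrMl ?normr_gt0//.
  apply: (le_trans (fd h)); rewrite -real_normK ?num_real// expr2.
  by rewrite ler_wpM2l.
have dv : derivable f x 1 by apply/cvg_ex; exists d.
by split => //; apply: cvg_lim cv; exact: Rhausdorff.
Unshelve. all: by end_near. Qed.

(** Squaring removes the corner of the positive part at 0 and makes it C^1. *)
Definition pos_sqr (R : realType) (x : R) : R := Num.max x 0 ^+ 2.

Lemma is_derive_pos_sqr (R : realType) (x : R) :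
  is_derive x 1 (@pos_sqr R) (2 * Num.max x 0).
Proof.
(* The remainder is at most [h ^+ 2] even when [x] and [x + h] lie on opposite sides of 0. *)
apply: is_derive_quadratic => h; rewrite /pos_sqr ler_norml.
by rewrite /Num.max; case: ltP => ?; case: ltP => ?; apply/andP; split; nra.
Qed.

(** A C^1 function that is positive exactly on ]p, q[. *)
Definition bump (R : realType) (p q x : R) : R := pos_sqr (x - p) * pos_sqr (q - x).

Definition bump' (R : realType) (p q x : R) : R :=
  2 * Num.max (x - p) 0 * pos_sqr (q - x) - pos_sqr (x - p) * (2 * Num.max (q - x) 0).

Lemma is_derive_bump (R : realType) (p q x : R) :
  is_derive x 1 (bump p q) (bump' p q x).
Proof.
have d1 : is_derive x 1 (fun x => pos_sqr (x - p)) (2 * Num.max (x - p) 0).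
  have h := is_derive_pos_sqr (x - p).
  have hs : is_derive x 1 (fun x => x - p) 1 by apply: is_derive_eq; rewrite subr0.
  by have := @is_derive1_comp _ (@pos_sqr R) (fun x => x - p) x _ _ h hs; rewrite mulr1.
have d2 : is_derive x 1 (fun x => pos_sqr (q - x)) (- (2 * Num.max (q - x) 0)).
  have h := is_derive_pos_sqr (q - x).
  have hs : is_derive x 1 (fun x => q - x) (-1).
    by apply: is_derive_eq; rewrite add0r mul1r.
  by have := @is_derive1_comp _ (@pos_sqr R) (fun x => q - x) x _ _ h hs; rewrite mulrN1.
have -> : bump p q = (fun x => pos_sqr (x - p)) * (fun x => pos_sqr (q - x)) by [].
by apply: is_derive_eq; rewrite /bump' /GRing.scale/=; ring.
Qed.

Lemma bump_ge0 (R : realType) (p q x : R) : 0 <= bump p q x.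
Proof. by rewrite mulr_ge0 ?sqr_ge0. Qed.

Lemma bump_out (R : realType) (p q x : R) : ~~ (p < x < q) ->
  bump p q x = 0 /\ bump' p q x = 0.
Proof.
rewrite negb_and -!leNgt => /orP[xp|qx]; rewrite /bump /bump' /pos_sqr.
  by rewrite (@max_r _ _ (x - p)) ?subr_le0// expr0n/= !(mul0r, mulr0) subrr.
by rewrite (@max_r _ _ (q - x)) ?subr_le0// expr0n/= !(mul0r, mulr0) subrr.
Qed.

Lemma bump_in (R : realType) (p q x : R) : p < x < q -> 0 < bump p q x.
Proof.
by move=> /andP[px xq]; rewrite mulr_gt0// exprn_gt0// lt_max subr_gt0 ?px ?xq.
Qed.

(* y |-> 1 - 1 / (1 + n y) is bounded, vanishes at 0 and tends to 1 elsewhere,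
   so these C^1 functions approximate the indicator of ]p, q[. *)
Definition plateau (R : realType) (p q : R) (n : nat) (x : R) : R :=
  1 - (1 + n%:R * bump p q x)^-1.

(** The bounds on [p] and [q] put ]p, q[ inside [-M, M]; the denominator is at least 1 because
    [bump] is nonnegative. *)
Lemma plateau_C1 (R : realType) (p q M : R) (n : nat) : `|p| <= M -> `|q| <= M ->
  exists a', compact_C1 M (plateau p q n) a'.
Proof.
move=> pM qM.
have pos x : 0 < 1 + n%:R * bump p q x by rewrite ltr_pwDl// mulr_ge0// bump_ge0.
exists (fun x => n%:R * bump' p q x * (1 + n%:R * bump p q x) ^- 2).
have dN (x : R) : is_derive x 1 (fun x => 1 + n%:R * bump p q x) (n%:R * bump' p q x).
  have := is_derive_bump p q x => ?.
  by apply: is_derive_eq; rewrite add0r mul1r.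
have out x : M < `|x| -> ~~ (p < x < q).
  move=> Mx; apply/negP => /andP[px xq].
  suff : `|x| <= M by rewrite leNgt Mx.
  rewrite ler_norml (le_trans _ (ltW px)) ?(le_trans (ltW xq))//.
    by rewrite (le_trans (ler_norm _)).
  by rewrite lerNl (le_trans _ pM)// -normrN ler_norm.
split.
- move=> x; have := dN x => ?.
  have ne0 : 1 + n%:R * bump p q x != 0 by rewrite gt_eqF.
  have dV : is_derive x 1 (fun x => (1 + n%:R * bump p q x)^-1)
      (- (1 + n%:R * bump p q x) ^- 2 *: (n%:R * bump' p q x)).
    have [dN1 dN2] := dN x.
    by split; [exact: derivableV|rewrite deriveV// dN2].
  apply: is_derive_eq; rewrite /GRing.scale/=; ring.
- have cm (c : R) (f : R -> R) : continuous f -> continuous (fun x => Num.max (f x) c).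
    move=> cf x; apply: (@continuous_max _ _ f (fun=> c)); first exact: cf.
    exact: cvg_cst.
  have cxp : continuous (fun x => x - p).
    by move=> x; apply: cvgB; [exact: cvg_id|exact: cvg_cst].
  have cqx : continuous (fun x => q - x).
    by move=> x; apply: cvgB; [exact: cvg_cst|exact: cvg_id].
  have cM (f g : R -> R) : continuous f -> continuous g -> continuous (fun x => f x * g x).
    by move=> cf cg x; apply: cvgM; [exact: cf|exact: cg].
  have cst (c : R) : continuous (fun _ : R => c) by move=> x; exact: cvg_cst.
  have cs (f : R -> R) : continuous f -> continuous (fun x => pos_sqr (f x)).
    by move=> cf; apply: cM; exact: cm.
  have cb' : continuous (bump' p q).
    move=> x; apply: cvgB.
      by apply: (cM _ _ (cM _ _ (cst 2) (cm 0 _ cxp)) (cs _ cqx)).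
    by apply: (cM _ _ (cs _ cxp) (cM _ _ (cst 2) (cm 0 _ cqx))).
  have cb : continuous (bump p q).
    by apply: (cM _ _ (cs _ cxp) (cs _ cqx)).
  have c1 : continuous (fun x => 1 + n%:R * bump p q x).
    by move=> x; apply: cvgD; [exact: cst|exact: (cM _ _ (cst n%:R) cb x)].
  apply: (cM (fun x => n%:R * bump' p q x)); first exact: cM.
  move=> x; apply: cvgV; first by rewrite expf_eq0 gt_eqF.
  exact: (cM _ _ c1 c1 x).
- by move=> x /out/bump_out[x0 _]; rewrite /plateau x0 mulr0 addr0 invr1 subrr.
- by move=> x /out/bump_out[_ x0]; rewrite x0 mulr0 mul0r.
Qed.

Lemma plateau_bound (R : realType) (p q : R) (n : nat) (x : R) :
  0 <= plateau p q n x <= 1.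
Proof.
have pos : 1 <= 1 + n%:R * bump p q x by rewrite lerDl mulr_ge0// bump_ge0.
rewrite /plateau subr_ge0 invf_le1 ?(lt_le_trans ltr01)// pos/= gerBl invr_ge0.
exact: le_trans ler01 pos.
Qed.

Lemma plateau_cvg (R : realType) (p q : R) (x : R) :
  plateau p q n x @[n --> \oo] --> (\1_(`]p, q[%classic : set R) x : R).
Proof.
rewrite indicE; have [xpq|xpq] := boolP (p < x < q); last first.
  rewrite memNset/= ?in_itv/=; last exact/negP.
  under eq_fun do rewrite /plateau (bump_out xpq).1 mulr0 addr0 invr1 subrr.
  exact: cvg_cst.
rewrite mem_set/= ?in_itv//= /plateau -[X in _ --> X]subr0.
apply: cvgB; first exact: cvg_cst.
have b0 := bump_in xpq.
apply/gtr0_cvgV0.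
  by apply: nearW => n; rewrite ltr_pwDl// mulr_ge0// bump_ge0.
apply/cvgryPge => A; near=> n.
rewrite (@le_trans _ _ (n%:R * bump p q x))// ?lerDr//.
rewrite -ler_pdivrMr//.
by near: n; exact: nbhs_infty_ger.
Unshelve. all: by end_near. Qed.

(** * Integrals off null sets, and currents on continuous forms *)

Section off_null.
Context d (T : measurableType d) (R : realType).
Variable mu : {measure set T -> \bar R}.
Import HBNNSimple.

(** The integral is a supremum over simple functions below [f]. Cutting such a function to the
    complement of [N] keeps its integral and brings it below [g], so measurability of [f] does not
    enter. *)
Let ge0_le_integral_off_null (f g : T -> \bar R) (N : set T) :
  measurable N -> mu N = 0%E -> (forall x, 0 <= f x)%E -> (forall x, 0 <= g x)%E ->
  (forall x, ~ N x -> f x = g x) ->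
  (\int[mu]_x f x <= \int[mu]_x g x)%E.
Proof.
move=> mN N0 f0 g0 fg.
rewrite !ge0_integralTE//; apply: ge_ereal_sup => _ [h /= hf <-].
have mC : measurable (~` N) by exact: measurableC.
have -> : sintegral mu h = sintegral mu (proj_nnsfun h mC).
  rewrite -mrestrict -integral_nnsfun// -setTD -ge0_negligible_integral//.
  - by rewrite integral_nnsfun// patch_setT.
  - exact/measurable_EFinP.
  - by move=> x _; rewrite lee_fin.
apply: ereal_sup_ubound => /=; exists (proj_nnsfun h mC) => // x.
rewrite -mrestrict patchE; case: ifPn => //.
by rewrite inE => /fg <-.
Qed.

(* f is not assumed to be measurable: it will involve the velocity of a curve,
   which takes junk values where the curve is not derivable. *)
Lemma integral_off_null (D : set T) (f g : T -> \bar R) (N : set T) :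
  measurable N -> mu N = 0%E -> (forall x, D x -> ~ N x -> f x = g x) ->
  (\int[mu]_(x in D) f x = \int[mu]_(x in D) g x)%E.
Proof.
move=> mN N0 fg.
rewrite integralE [RHS]integralE.
have H (f1 g1 : T -> \bar R) : (forall x, 0 <= f1 x)%E -> (forall x, 0 <= g1 x)%E ->
    (forall x, D x -> ~ N x -> f1 x = g1 x) ->
    (\int[mu]_(x in D) f1 x = \int[mu]_(x in D) g1 x)%E.
  move=> f0 g0 e; rewrite integral_mkcond [RHS]integral_mkcond.
  have e' x : ~ N x -> (f1 \_ D) x = (g1 \_ D) x.
    by move=> Nx; rewrite !patchE; case: ifPn => //; rewrite inE => Dx; exact: e.
  apply/le_anti/andP; split.
    by apply: (@ge0_le_integral_off_null _ _ N) => // [x|x]; rewrite ?erestrict_ge0//.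
  by apply: (@ge0_le_integral_off_null _ _ N) => // [x|x|x /e']; rewrite ?erestrict_ge0//.
congr (_ - _)%E; apply: H => // x Dx Nx.
- by rewrite !funeposE fg.
- by rewrite !funenegE fg.
Qed.

End off_null.

(** True in both cases of [xget]: a chosen functional satisfies [is_current], and the default value
    is [line_integral phi] itself. *)
Lemma current_continuous (R : realType) (sigma : R) (Omega : set (R * R))
    (phi alpha : R * R -> R * R) :
  H1Lambda1 Omega alpha -> {within Omega, continuous alpha} ->
  current sigma Omega phi alpha = line_integral phi alpha.
Proof.
by move=> Ha ca; rewrite /current; case: xgetP => // T _ [_]; exact.
Qed.

Lemma derive1_pair (R : realType) (f : R -> R * R) (t d1 d2 : R) :
  is_derive t 1 (fst \o f) d1 -> is_derive t 1 (snd \o f) d2 ->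
  derive1 f t = (d1, d2).
Proof.
move=> [df1 <-] [df2 <-]; rewrite derive1E.
apply: cvg_lim; first exact: norm_hausdorff.
exact: cvg_pair df1 df2.
Qed.

(** * The circle *)

Section circle.
Context (R : realType).
Implicit Types (s t u x : R) (z : R * R) (k : int).

Lemma circ_S1 t : S1 R (circ t).
Proof. exact: cos2Dsin2. Qed.

Lemma circ_add2pi t : circ (t + 2 * pi) = circ t.
Proof.
have e : 2 * pi = (pi : R) *+ 2 by rewrite mulr_natl.
by rewrite /circ e sinD2pi cosD2pi.
Qed.

Lemma circ_periodic t k : circ (t + 2 * pi * k%:~R) = circ t.
Proof.
have pos (n : nat) u : circ (u + 2 * pi * n%:R) = circ u.
  elim: n => [|n IH]; first by rewrite mulr0 addr0.
  by rewrite -(natr1 n) mulrDr mulr1 addrA circ_add2pi.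
case: k => n; first exact: pos.
by rewrite NegzE mulrNz mulrN -[in RHS](subrK (2 * pi * n.+1%:R) t) pos.
Qed.

Lemma modulo_period (p x : R) : 0 < p -> exists k, 0 <= x - p * k%:~R < p.
Proof.
move=> p0; exists (Num.floor (x / p)).
have /andP[] := floor_itv (x / p).
rewrite ler_pdivlMr// ltr_pdivrMr// intrD mulrDl mul1r [_%:~R * p]mulrC => ? ?.
by apply/andP; split; lra.
Qed.

Lemma circB s t : circ (s - t) =
  ((circ s).1 * (circ t).1 + (circ s).2 * (circ t).2,
   (circ s).2 * (circ t).1 - (circ s).1 * (circ t).2).
Proof. by rewrite /circ cosB sinB. Qed.

(** Modulo the period, [s - t] is some [r] in [0, 2 pi[ with [cos r = 1]. The half-angle formula
    gives [sin (r / 2) = 0], whereas sine is positive on ]0, pi[. *)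
Lemma circ_eqP s t : circ s = circ t <-> exists k, s = t + 2 * pi * k%:~R.
Proof.
have pi2 : 0 < 2 * pi :> R by rewrite mulr_gt0// pi_gt0.
split; last by move=> [k ->]; rewrite circ_periodic.
move=> st; have [k /andP[r0 r2pi]] := modulo_period (s - t) pi2.
exists k; set r := s - t - _ in r0 r2pi.
suff : r = 0 by rewrite /r; lra.
have : circ r = circ 0.
  rewrite /r -mulrN -mulrNz circ_periodic circB st -circB subrr.
  by [].
move=> [cr _].
have : sin (r / 2) ^+ 2 = 0.
  move: cr; rewrite cos0 [in cos r](splitr r) cosD -!expr2 cos2sin2; lra.
move=> /eqP; rewrite sqrf_eq0 => /eqP sr.
apply/eqP; rewrite eq_le r0 andbT leNgt; apply/negP => rgt0.
suff : 0 < sin (r / 2) by rewrite sr ltxx.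
by apply: sin_gt0_pi; apply/andP; split; lra.
Qed.

(** [acos] recovers the angle up to sign, and the sign of the second coordinate decides. *)
Lemma circ_surj z : S1 R z -> exists t, circ t = z.
Proof.
case: z => x y; rewrite /S1/= => xy.
have x1 : -1 <= x <= 1 by apply/andP; split; nra.
have sa : sin (acos x) = `|y|.
  by rewrite sin_acos// -sqrtr_sqr; congr Num.sqrt; lra.
have [y0|y0] := leP 0 y.
  by exists (acos x); rewrite /circ acosK ?in_itv// sa ger0_norm.
by exists (- acos x); rewrite /circ cosN sinN acosK ?in_itv// sa ltr0_norm// opprK.
Qed.

Lemma lipschitz_of_derive (f df : R -> R) : (forall x, is_derive x 1 f (df x)) ->
  (forall x, `|df x| <= 1) -> forall x y, `|f x - f y| <= `|x - y|.
Proof.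
move=> fdf df1.
have cf : continuous f.
  by move=> x; apply: differentiable_continuous; apply/derivable1_diffP; have [] := fdf x.
have H x y : x <= y -> `|f y - f x| <= `|y - x|.
  move=> xy.
  have [c _ ->] := MVT_segment xy (fun x _ => fdf x) (continuous_subspaceT cf).
  by rewrite normrM ler_piMl.
move=> x y; have [xy|/ltW yx] := leP x y; last exact: H.
by rewrite distrC (distrC x); exact: H.
Qed.

Lemma circ_lipschitz s t : `|circ s - circ t| <= `|s - t|.
Proof.
(* The plane carries the maximum norm, so cosine and sine are bounded separately. *)
rewrite prod_normE/= ge_max; apply/andP; split.
  apply: (@lipschitz_of_derive _ (fun x => - sin x)) => x.
  by rewrite normrN ler_norml sin_geN1 sin_le1.
apply: (@lipschitz_of_derive _ cos) => x.
by rewrite ler_norml cos_geN1 cos_le1.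
Qed.

Lemma circ_continuous : continuous (@circ R).
Proof. by apply: pair_continuous; [exact: continuous_cos|exact: continuous_sin]. Qed.

Lemma S1_compact : compact (S1 R).
Proof.
suff -> : S1 R = (@circ R) @` `[0, 2 * pi]%classic.
  apply: continuous_compact; last exact: segment_compact.
  by apply: continuous_subspaceT; exact: circ_continuous.
apply/seteqP; split => [z|_ [t _ <-]]; last exact: circ_S1.
move=> /circ_surj[t <-].
have [k /andP[k0 k1]] := @modulo_period (2 * pi) t (ltac:(by rewrite mulr_gt0// pi_gt0)).
exists (t - 2 * pi * k%:~R); first by rewrite /= in_itv/= k0 ltW.
by rewrite -mulrN -mulrNz circ_periodic.
Qed.

End circle.

(** * Equality of signed image measures *)

Section pushforward.
Context d (T : measurableType d) (R : realType).
Variable mu : {measure set T -> \bar R}.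

(* The signed measure of density v, pushed forward along X. *)
Definition push_charge (T' : Type) (D : set T) (X : T -> T') (v : T -> R)
    (A : set T') : \bar R :=
  (\int[mu]_(t in D `&` X @^-1` A) (v t)%:E)%E.

(** The sets on which the two charges agree form a Dynkin system: complements follow from equal,
    finite total charges, disjoint unions from countable additivity. *)
Lemma push_charge_dynkin d' (T' : measurableType d') (G : set (set T'))
    (D E : set T) (X Y : T -> T') (v w : T -> R) :
  measurable D -> measurable E ->
  measurable_fun setT X -> measurable_fun setT Y ->
  mu.-integrable D (EFin \o v) -> mu.-integrable E (EFin \o w) ->
  @measurable _ T' = <<s G >> -> setI_closed G ->
  push_charge D X v setT = push_charge E Y w setT ->
  (forall A, G A -> push_charge D X v A = push_charge E Y w A) ->
  forall A, measurable A -> push_charge D X v A = push_charge E Y w A.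
Proof.
move=> mD mE mX mY iv iw GE GI eqT eqG A; rewrite GE.
apply: (dynkin_induction (P := fun A => push_charge D X v A = push_charge E Y w A)) => //.
- move=> S mS.
  have compl (F : set T) (Z : T -> T') (u : T -> R) : measurable F ->
      measurable_fun setT Z -> mu.-integrable F (EFin \o u) ->
      push_charge F Z u (~` S) = (push_charge F Z u setT - push_charge F Z u S)%E.
    move=> mF mZ iu; rewrite /push_charge preimage_setT setIT.
    have mZS : measurable (Z @^-1` S).
      by rewrite -[_ @^-1` _]setTI; exact: mZ.
    have FE : F = (F `&` Z @^-1` (~` S)) `|` (F `&` Z @^-1` S).
      by rewrite preimage_setC setUC -setDE setUIDK.
    have iS : mu.-integrable (F `&` Z @^-1` S) (EFin \o u).
      by apply: (integrableS _ _ _ iu) => //; exact: measurableI.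
    rewrite [in X in (X - _)%E]FE integral_setU//.
    - by rewrite addeK// integrable_fin_num//; exact: measurableI.
    - by apply: measurableI => //; rewrite preimage_setC; exact: measurableC.
    - exact: measurableI.
    - by rewrite -FE; exact: measurable_int iu.
    - apply/disj_setPS => t [[_ +] [_]] /=; rewrite /preimage/=; exact.
  by move=> e; rewrite !compl// eqT e.
- move=> F mF tF eF.
  have bigc (H : set T) (Z : T -> T') (u : T -> R) : measurable H ->
      measurable_fun setT Z -> mu.-integrable H (EFin \o u) ->
      push_charge H Z u (\bigcup_k F k) = (\sum_(k <oo) push_charge H Z u (F k))%E.
    move=> mH mZ iu; rewrite /push_charge preimage_bigcup setI_bigcupr.
    have mZF k : measurable (H `&` Z @^-1` (F k)).
      by apply: measurableI => //; rewrite -[_ @^-1` _]setTI; exact: mZ.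
    rewrite integral_bigcup//.
      by apply/trivIsetP => i j _ _ ij; rewrite setIACA setIid -preimage_setI;
         move/trivIsetP : tF => /(_ i j Logic.I Logic.I ij) ->; rewrite preimage_set0 setI0.
    apply: (integrableS _ _ _ iu) => //; first exact: bigcupT_measurable.
    by move=> t [k _ []].
  by rewrite !bigc//; apply: eq_eseriesr => k _; exact: eF.
Qed.

Notation plane := (measurableTypeR R * measurableTypeR R)%type.

Lemma plateau_measurable (p q : R) (n : nat) :
  measurable_fun [set: measurableTypeR R] (plateau p q n).
Proof.
apply: continuous_measurable_fun.
have pM : `|p| <= `|p| + `|q| by rewrite lerDl.
have qM : `|q| <= `|p| + `|q| by rewrite lerDr.
have [a' Ca] := plateau_C1 n pM qM.
exact: compact_C1_continuous Ca.
Qed.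

(** Dominated convergence: the products of plateaus lie in [0, 1] and tend pointwise to the
    indicator of the rectangle, so the norm of [v] dominates. *)
Lemma push_charge_rectangle (D : set T) (X : T -> plane) (v : T -> R) (p q p' q' : R) :
  measurable D -> measurable_fun setT X -> mu.-integrable D (EFin \o v) ->
  (\int[mu]_(t in D)
    (plateau p q n (X t).1 * plateau p' q' n (X t).2 * v t)%:E)%E
      @[n --> \oo] -->
  push_charge D X v (`]p, q[%classic `*` `]p', q'[%classic).
Proof.
move=> mD mX iv.
have m1 : measurable_fun setT (fun t => (X t).1).
  by apply: measurableT_comp mX; exact: measurable_fst.
have m2 : measurable_fun setT (fun t => (X t).2).
  by apply: measurableT_comp mX; exact: measurable_snd.
have mv : measurable_fun D v by apply/measurable_EFinP; exact: measurable_int iv.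
pose lim t : R := \1_(`]p, q[%classic : set R) (X t).1 *
  \1_(`]p', q'[%classic : set R) (X t).2 * v t.
have limE t : (lim t)%:E =
    ((fun t => (v t)%:E) \_ (X @^-1` (`]p, q[%classic `*` `]p', q'[%classic))) t.
  rewrite patchE /lim !indicE.
  case: ifPn => [|/negP].
    by rewrite inE => -[/= h1 h2]; rewrite !mem_set// !mul1r.
  move=> h.
  have [h1|h1] := boolP ((X t).1 \in (`]p, q[%classic : set R)); last by rewrite !mul0r.
  have [h2|h2] := boolP ((X t).2 \in (`]p', q'[%classic : set R)); last by rewrite mulr0 mul0r.
  by exfalso; apply: h; rewrite inE; split; apply: set_mem.
rewrite /push_charge integral_mkcondr.
under [X in _ --> X]eq_integral do rewrite -limE.
have mpl n : measurable_fun D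
    (fun t => plateau p q n (X t).1 * plateau p' q' n (X t).2 * v t).
  apply: measurable_funM => //; apply: measurable_funTS; apply: measurable_funM.
    by apply: measurableT_comp m1; exact: plateau_measurable.
  by apply: measurableT_comp m2; exact: plateau_measurable.
have mlim : measurable_fun D lim.
  apply: measurable_funM => //; apply: measurable_funTS; apply: measurable_funM.
    apply: measurableT_comp m1; exact: measurable_indic.
  apply: measurableT_comp m2; exact: measurable_indic.
pose f_ n t := (plateau p q n (X t).1 * plateau p' q' n (X t).2 * v t)%:E.
have H1 : {ae mu, forall t, D t -> f_ ^~ t @ \oo --> (lim t)%:E}.
  apply: aeW => t _; apply: cvg_EFin; first by apply: nearW => n.
  apply: cvgM; last exact: cvg_cst.
  by apply: cvgM; exact: plateau_cvg.
have H2 : {ae mu, forall t n, D t -> (`|f_ n t| <= ((Num.norm \o v) t)%:E)%E}.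
  apply: aeW => t n _ /=; rewrite lee_fin !normrM ler_piMl//.
  have /andP[a0 a1] := plateau_bound p q n (X t).1.
  have /andP[b0 b1] := plateau_bound p' q' n (X t).2.
  by rewrite !ger0_norm// mulr_ile1.
have mf n : measurable_fun D (f_ n) by apply/measurable_EFinP; exact: mpl.
have ml : measurable_fun D (EFin \o lim) by exact/measurable_EFinP.
by have [_ _] := dominated_convergence mD mf ml H1 (integrable_norm iv) H2.
Qed.

(** Open intervals form a generating family stable under intersection. The bound [N] makes the total
    charge that of the single interval ]-N, N[. *)
Lemma push_charge_line (D E : set T) (X Y : T -> measurableTypeR R)
    (v w : T -> R) (N : R) :
  measurable D -> measurable E ->
  measurable_fun setT X -> measurable_fun setT Y ->
  mu.-integrable D (EFin \o v) -> mu.-integrable E (EFin \o w) ->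
  (forall t, D t -> `|X t| < N) -> (forall t, E t -> `|Y t| < N) ->
  (forall p q : R, push_charge D X v `]p, q[%classic = push_charge E Y w `]p, q[%classic) ->
  forall A, measurable A -> push_charge D X v A = push_charge E Y w A.
Proof.
move=> mD mE mX mY iv iw XN YN H.
apply: (push_charge_dynkin mD mE mX mY iv iw (RGenOpens.measurableE R)).
- move=> _ _ [a [b ->]] [c [e ->]].
  exists (Num.max a c), (Num.min b e); apply/seteqP; split => x /=; rewrite !in_itv/=.
    by move=> [/andP[? ?] /andP[? ?]]; rewrite gt_max lt_min; apply/andP; split; apply/andP.
  by rewrite gt_max lt_min => /andP[/andP[-> ->] /andP[-> ->]].
- have bounded (F : set T) (Z : T -> measurableTypeR R) u : (forall t, F t -> `|Z t| < N) ->
      push_charge F Z u setT = push_charge F Z u `](- N), N[%classic.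
    move=> ZN; rewrite /push_charge; congr integral; apply/seteqP; split => t [] //= Ft _.
    by split => //=; rewrite in_itv/= -ltr_norml ZN.
  by rewrite !bounded//; exact: H.
- by move=> _ [a [b ->]]; exact: H.
Qed.

(** Agreement passes from open rectangles to Borel ones one side at a time ([S0], [S1], [S2]), and
    from these to all Borel sets. *)
Lemma push_charge_plane (D : set T) (X Y : T -> plane) (v w : T -> R) (N : R) :
  measurable D -> measurable_fun setT X -> measurable_fun setT Y ->
  mu.-integrable D (EFin \o v) -> mu.-integrable D (EFin \o w) ->
  (forall t, D t -> `|(X t).1| < N /\ `|(X t).2| < N) ->
  (forall t, D t -> `|(Y t).1| < N /\ `|(Y t).2| < N) ->
  (forall p q p' q' n,
    (\int[mu]_(t in D) (plateau p q n (X t).1 * plateau p' q' n (X t).2 * v t)%:E =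
     \int[mu]_(t in D) (plateau p q n (Y t).1 * plateau p' q' n (Y t).2 * w t)%:E)%E) ->
  forall A, measurable A -> push_charge D X v A = push_charge D Y w A.
Proof.
move=> mD mX mY iv iw XN YN H.
have m1 (Z : T -> plane) : measurable_fun setT Z -> measurable_fun setT (fst \o Z).
  by move=> mZ; apply: measurableT_comp mZ; exact: measurable_fst.
have m2 (Z : T -> plane) : measurable_fun setT Z -> measurable_fun setT (snd \o Z).
  by move=> mZ; apply: measurableT_comp mZ; exact: measurable_snd.
have mpre (Z : T -> measurableTypeR R) (A : set (measurableTypeR R)) :
    measurable_fun setT Z -> measurable A -> measurable (D `&` Z @^-1` A).
  by move=> mZ mA; apply: measurableI => //; rewrite -[_ @^-1` _]setTI; exact: mZ.
(* Restricting the parameters to the preimage of a fixed side turns a charge of rectangles into a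
   charge on the line. *)
have split1 (Z : T -> plane) u A B : push_charge (D `&` (snd \o Z) @^-1` B) (fst \o Z) u A =
    push_charge D Z u (A `*` B).
  by rewrite /push_charge -setIA [X in D `&` X]setIC.
have split2 (Z : T -> plane) u A B : push_charge (D `&` (fst \o Z) @^-1` A) (snd \o Z) u B =
    push_charge D Z u (A `*` B).
  by rewrite /push_charge -setIA.
have S0 p q p' q' : push_charge D X v (`]p, q[%classic `*` `]p', q'[%classic) =
    push_charge D Y w (`]p, q[%classic `*` `]p', q'[%classic).
  have := @push_charge_rectangle D X v p q p' q' mD mX iv.
  under eq_fun do rewrite H.
  move=> cX; apply: (cvg_unique _ cX); first exact: ereal_hausdorff.
  exact: push_charge_rectangle.
have S1 p' q' A : measurable A -> push_charge D X v (A `*` `]p', q'[%classic) =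
    push_charge D Y w (A `*` `]p', q'[%classic).
  rewrite -!split1; apply: (@push_charge_line _ _ _ _ _ _ N).
  - by apply: mpre => //; exact: m2.
  - by apply: mpre => //; exact: m2.
  - exact: m1.
  - exact: m1.
  - by apply: (integrableS _ _ _ iv) => //; apply: mpre => //; exact: m2.
  - by apply: (integrableS _ _ _ iw) => //; apply: mpre => //; exact: m2.
  - by move=> t [/XN[]].
  - by move=> t [/YN[]].
  - by move=> p q; rewrite !split1.
have S2 A B : measurable A -> measurable B -> push_charge D X v (A `*` B) =
    push_charge D Y w (A `*` B).
  move=> mA; rewrite -!split2; apply: (@push_charge_line _ _ _ _ _ _ N).
  - by apply: mpre => //; exact: m1.
  - by apply: mpre => //; exact: m1.
  - exact: m2.
  - exact: m2.
  - by apply: (integrableS _ _ _ iv) => //; apply: mpre => //; exact: m1.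
  - by apply: (integrableS _ _ _ iw) => //; apply: mpre => //; exact: m1.
  - by move=> t [/XN[]].
  - by move=> t [/YN[]].
  - by move=> p q; rewrite !split2; exact: S1.
apply: (push_charge_dynkin mD mD mX mY iv iw (measurable_prod_measurableType _ _)).
- move=> _ _ [A1 mA1 [B1 mB1 <-]] [A2 mA2 [B2 mB2 <-]].
  exists (A1 `&` A2); first exact: measurableI.
  by exists (B1 `&` B2); [exact: measurableI|rewrite setXI].
- by rewrite -setXTT; exact: S2.
- by move=> _ [A mA [B mB <-]]; exact: S2.
Qed.

End pushforward.

(** * The current of a curve as a vector measure *)

Section curves.
Context (R : realType).
Notation mu := (@lebesgue_measure R).
Notation plane := (measurableTypeR R * measurableTypeR R)%type.
Implicit Types (Omega : set (R * R)) (phi : R * R -> R * R).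

Lemma lipschitz_circ (f : R * R -> R) (k : R) : k.-lipschitz_(S1 R) f ->
  forall s t, `|f (circ s) - f (circ t)| <= `|k| * `|s - t|.
Proof.
move=> fk s t; have := fk (circ s, circ t).
rewrite /= => /(_ _)/le_trans; apply; first by split; exact: circ_S1.
apply: (@le_trans _ _ (`|k| * `|circ s - circ t|)).
  by rewrite ler_wpM2r// ler_norm.
by rewrite ler_wpM2l// circ_lipschitz.
Qed.

Lemma immersion_continuous Omega phi : lipschitz_immersion Omega phi ->
  continuous (phi \o @circ R).
Proof.
move=> [_ [k1 h1] [k2 h2] _].
have -> : phi \o @circ R = (fun t => ((phi (circ t)).1, (phi (circ t)).2)).
  by apply/funext => t /=; case: (phi _).
apply: pair_continuous.
  exact: lipschitz_continuous (lipschitz_circ h1).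
exact: lipschitz_continuous (lipschitz_circ h2).
Qed.

(* v is the almost everywhere derivative of the component pr of the curve, and
   form u is u dx_1 or u dx_2. *)
Definition line_density phi (pr : R * R -> R) (form : (R * R -> R) -> R * R -> R * R)
    (v : R -> R) : Prop :=
  [/\ mu.-integrable `[0, 2 * pi] (EFin \o v),
      forall a b, 0 <= a -> a <= b -> b <= 2 * pi ->
        \int[mu]_(t in `[a, b]) v t = pr (phi (circ b)) - pr (phi (circ a)) &
      forall u, line_integral phi (form u) =
        \int[mu]_(t in `[0, 2 * pi]) (u (phi (circ t)) * v t)].

Definition form1 (u : R * R -> R) (z : R * R) : R * R := (u z, 0).
Definition form2 (u : R * R -> R) (z : R * R) : R * R := (0, u z).

(** The densities given by [lipschitz_ftc] agree with the velocity almost everywhere, hence give the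
    same line integrals. *)
Lemma immersion_density Omega phi : lipschitz_immersion Omega phi ->
  exists v1 v2, line_density phi fst form1 v1 /\ line_density phi snd form2 v2.
Proof.
move=> [_ [k1 h1] [k2 h2] _].
have pi2 : 0 < 2 * pi :> R by rewrite mulr_gt0// pi_gt0.
have [v1 [mv1 iv1 Iv1 dv1]] := lipschitz_ftc (lipschitz_circ h1) pi2.
have [v2 [mv2 iv2 Iv2 dv2]] := lipschitz_ftc (lipschitz_circ h2) pi2.
have : {ae mu, forall t, 0 < t < 2 * pi -> velocity phi t = (v1 t, v2 t)}.
  have F := ae_filter_ringOfSetsType mu.
  apply: filterS2 dv1 dv2 => t d1 d2 /[dup] /d1 {}d1 /d2 {}d2.
  exact: derive1_pair.
move=> [N0 [mN0 N00 subN]].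
(* The end points join the null set because derivatives are known only on the open interval. *)
pose N : set (measurableTypeR R) := N0 `|` ([set 0] `|` [set 2 * pi]).
have mN : measurable N.
  by apply: measurableU => //; apply: measurableU; exact: measurable_set1.
have N_0 : mu N = 0.
  rewrite /N null_set_setU//; last 2 first.
  - by apply: measurableU; exact: measurable_set1.
  - by rewrite null_set_setU//; exact: lebesgue_measure_set1.
have velE t : `[0, 2 * pi]%classic t -> ~ N t -> velocity phi t = (v1 t, v2 t).
  rewrite /= in_itv/= => /andP[t0 t2] Nt.
  apply: contrapT => nv; apply: Nt.
  have [->|t0'] := eqVneq t 0; first by right; left.
  have [->|t2'] := eqVneq t (2 * pi); first by right; right.
  left; apply: subN => /= H; apply: nv; apply: H.
  by rewrite !lt_neqAle eq_sym t0' t0 t2' t2.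
exists v1, v2; split; split => // u.
- rewrite /line_integral /Rintegral; congr fine.
  apply: (integral_off_null mN N_0) => t Dt Nt.
  by rewrite velE//= mul0r addr0.
- rewrite /line_integral /Rintegral; congr fine.
  apply: (integral_off_null mN N_0) => t Dt Nt.
  by rewrite velE//= mul0r add0r.
Qed.

(** What the forms [u dx_1] and [u dx_2] have in common, so that both components are treated by one
    argument. *)
Definition H1_tensor_form Omega (form : (R * R -> R) -> R * R -> R * R) : Prop :=
  forall (M : R) (a a' b b' : R -> R), compact_C1 M a a' -> compact_C1 M b b' ->
  H1Lambda1 Omega (form (fun z => a z.1 * b z.2)) /\
  continuous (form (fun z => a z.1 * b z.2)).

Lemma compact_C1_0 (M : R) : compact_C1 M (fun=> 0) (fun=> 0).
Proof.
split => // [x|x]; first exact: is_derive_cst.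
exact: cvg_cst.
Qed.

Lemma H1_zero Omega : open Omega -> H1 Omega (fun=> 0).
Proof.
move=> oO; have := @H1_tensor R Omega 0 _ _ _ _ oO (compact_C1_0 0) (compact_C1_0 0).
by under eq_fun do rewrite mul0r.
Qed.

Lemma form1_H1_tensor Omega : open Omega -> H1_tensor_form Omega form1.
Proof.
move=> oO M a a' b b' Ca Cb; split.
  by split; [exact: H1_tensor Ca Cb|exact: H1_zero].
apply: pair_continuous => z; last exact: cvg_cst.
by apply: tensor_continuous; [exact: compact_C1_continuous Ca|exact: compact_C1_continuous Cb].
Qed.

Lemma form2_H1_tensor Omega : open Omega -> H1_tensor_form Omega form2.
Proof.
move=> oO M a a' b b' Ca Cb; split.
  by split; [exact: H1_zero|exact: H1_tensor Ca Cb].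
apply: pair_continuous => z; first exact: cvg_cst.
by apply: tensor_continuous; [exact: compact_C1_continuous Ca|exact: compact_C1_continuous Cb].
Qed.

Lemma curve_measurable Omega phi : lipschitz_immersion Omega phi ->
  measurable_fun [set: measurableTypeR R] (phi \o @circ R : _ -> plane).
Proof.
move=> iphi; have cphi := immersion_continuous iphi.
apply/measurable_fun_pairP; split.
  apply: continuous_measurable_fun => t.
  by apply: continuous_comp; [exact: cphi|exact: cvg_fst].
apply: continuous_measurable_fun => t.
by apply: continuous_comp; [exact: cphi|exact: cvg_snd].
Qed.

Lemma curve_bounded Omega phi : lipschitz_immersion Omega phi ->
  exists N : R, forall t, `[0, 2 * pi]%classic t ->
    `|(phi (circ t)).1| < N /\ `|(phi (circ t)).2| < N.
Proof.
move=> iphi; have cphi := immersion_continuous iphi.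
have : compact ((phi \o @circ R) @` `[0, 2 * pi]%classic).
  apply: continuous_compact; last exact: segment_compact.
  exact: continuous_subspaceT.
move=> /compact_bounded[B [_ BP]]; exists (B + 2) => t It.
have : `|phi (circ t)| <= B + 1 by apply: BP; [rewrite ltrDl|exists t].
rewrite prod_normE/= ge_max => /andP[h1 h2].
by split; [apply: (le_lt_trans h1)|apply: (le_lt_trans h2)]; rewrite ltrD2l ltr1n.
Qed.

(** The test forms have a product of two plateaus as coefficient. They are continuous and of class
    H^1, so the currents are line integrals on them, which are the integrals compared in
    [push_charge_plane]. *)
Lemma push_charge_current Omega (sigma : R) phi1 phi2 pr form (v w : R -> R) :
  lipschitz_immersion Omega phi1 -> lipschitz_immersion Omega phi2 ->
  Hm1Lambda1_eq Omega (current sigma Omega phi1) (current sigma Omega phi2) ->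
  H1_tensor_form Omega form ->
  line_density phi1 pr form v -> line_density phi2 pr form w ->
  forall A : set plane, measurable A ->
  push_charge mu `[0, 2 * pi]%classic (phi1 \o @circ R) v A =
  push_charge mu `[0, 2 * pi]%classic (phi2 \o @circ R) w A.
Proof.
move=> i1 i2 cur Hform [iv _ Lv] [iw _ Lw].
have [N1 b1] := curve_bounded i1; have [N2 b2] := curve_bounded i2.
apply: (@push_charge_plane _ _ _ _ _ _ _ _ _ (Num.max N1 N2)) => //.
- exact: curve_measurable i1.
- exact: curve_measurable i2.
- by move=> t /b1[h1 h2]; rewrite !lt_max h1 h2.
- by move=> t /b2[h1 h2]; rewrite !lt_max h1 h2 !orbT.
move=> p q p' q' n.
(* A single bound for the supports of both factors, as [H1_tensor_form] requires. *)
pose M := `|p| + `|q| + `|p'| + `|q'|.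
have Ms : [/\ `|p| <= M, `|q| <= M, `|p'| <= M & `|q'| <= M].
  have := (normr_ge0 p, normr_ge0 q); have := (normr_ge0 p', normr_ge0 q').
  by rewrite /M => -[? ?] [? ?]; split; lra.
have [pM qM p'M q'M] := Ms.
have [a' Ca] := plateau_C1 n pM qM; have [b' Cb] := plateau_C1 n p'M q'M.
have [HL cL] := Hform _ _ _ _ _ Ca Cb.
have := cur _ HL.
have {}cL := continuous_subspaceT cL.
rewrite (current_continuous sigma phi1 HL (cL _)) (current_continuous sigma phi2 HL (cL _)).
rewrite Lv Lw /=.
pose f phi u t : R :=
  plateau p q n (phi (@circ R t)).1 * plateau p' q' n (phi (circ t)).2 * u t.
have if_ Om phi u : lipschitz_immersion Om phi -> mu.-integrable `[0, 2 * pi] (EFin \o u) ->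
    mu.-integrable `[0, 2 * pi] (EFin \o f phi u).
  move=> im iu; apply: (@le_integrable _ _ _ _ _ _ _ (EFin \o u)) => //.
    apply/measurable_EFinP; apply: measurable_funM; last first.
      by apply/measurable_EFinP; exact: measurable_int iu.
    have mc := curve_measurable im.
    apply: measurable_funTS; apply: measurable_funM.
      apply: (measurableT_comp (plateau_measurable p q n)).
      by apply: measurableT_comp mc; exact: measurable_fst.
    apply: (measurableT_comp (plateau_measurable p' q' n)).
    by apply: measurableT_comp mc; exact: measurable_snd.
  move=> t _ /=; rewrite lee_fin !normrM ler_piMl//.
  have /andP[a0 a1] := plateau_bound p q n (phi (circ t)).1.
  have /andP[c0 c1] := plateau_bound p' q' n (phi (circ t)).2.
  by rewrite !ger0_norm// mulr_ile1.
move=> vw.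
(* The currents give equality of real integrals; finiteness turns it into equality of extended
   ones. *)
rewrite -[LHS]fineK; last exact: integrable_fin_num (if_ _ _ _ i1 iv).
rewrite -[RHS]fineK; last exact: integrable_fin_num (if_ _ _ _ i2 iw).
by congr EFin.
Qed.

End curves.

(** * Charges of arcs of embedded curves *)

Section arcs.
Context (R : realType).
Notation mu := (@lebesgue_measure R).
Notation plane := (measurableTypeR R * measurableTypeR R)%type.
Implicit Types (Omega : set (R * R)) (phi : R * R -> R * R).

Let pi2 : 0 < 2 * pi :> R. Proof. by rewrite mulr_gt0// pi_gt0. Qed.

(** Shrinks an interval of angles until it lies strictly inside one period, away from the base point
    of the circle. *)
Lemma sub_period (a b : R) : a < b -> exists (k : int) (a' b' : R),
  [/\ a <= a', a' < b', b' <= b, 2 * pi * k%:~R < a' & b' < 2 * pi * k%:~R + 2 * pi].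
Proof.
move=> ab; have [k /andP[k0 k1]] := modulo_period a pi2.
pose m := Num.min b (2 * pi * k%:~R + 2 * pi).
have am : a < m by rewrite lt_min ab /=; lra.
have mb : m <= b by rewrite ge_min lexx.
have mk : m <= 2 * pi * k%:~R + 2 * pi by rewrite ge_min lexx orbT.
(* The points one third and two thirds of the way from [a] to [m], which makes the bounds of the
   period strict. *)
by exists k, ((a + a + m) / 3), ((a + m + m) / 3); split; lra.
Qed.

(** The angles differ by a multiple of the period, and a multiple smaller than one period is
    zero. *)
Lemma embedding_circ_inj Omega phi (s t : R) : lipschitz_embedding Omega phi ->
  phi (circ s) = phi (circ t) -> `|s - t| < 2 * pi -> s = t.
Proof.
move=> [_ [[_ inj _] _ _]] st d.
have /circ_eqP[k sk] : circ s = circ t.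
  by apply: inj => //; rewrite inE; exact: circ_S1.
move: d; rewrite sk addrAC subrr add0r normrM gtr0_norm// gtr_pMr//.
rewrite -intr_norm -[X in _ < X]/(1%:~R) ltr_int => k1.
have -> : k = 0 by apply/eqP; rewrite -normr_le0 -ltzD1 add0r.
by rewrite mulr0 addr0.
Qed.

(** By injectivity the parameters in [0, 2 pi] that reach the arc are exactly [a - p, b - p], where
    the density integrates to the increment. Strict bounds keep the arc off the base point, which
    both 0 and 2 pi reach. *)
Lemma arc_charge Omega phi pr form v (k : int) (a b : R) :
  lipschitz_embedding Omega phi -> line_density phi pr form v ->
  2 * pi * k%:~R < a -> a <= b -> b < 2 * pi * k%:~R + 2 * pi ->
  push_charge mu `[0, 2 * pi]%classic (phi \o @circ R : _ -> plane) v
    ((phi \o @circ R) @` `[a, b]%classic) =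
  (pr (phi (circ b)) - pr (phi (circ a)))%:E.
Proof.
move=> ephi [iv Iv _] ka ab bk.
set p := 2 * pi * k%:~R in ka bk.
have shift t : circ (t - p) = circ t.
  by rewrite /p -mulrN -mulrNz circ_periodic.
have := Iv (a - p) (b - p) (ltac:(lra)) (ltac:(lra)) (ltac:(lra)).
rewrite !shift => <-.
rewrite /push_charge /Rintegral fineK; last first.
  apply: integrable_fin_num => //; apply: (integrableS _ _ _ iv) => //.
  by apply: subset_itv; rewrite bnd_simp; lra.
congr integral; apply/seteqP; split => t /=; rewrite !in_itv/=.
  move=> [/andP[t0 t2] [s]]; rewrite /= in_itv/= => /andP[as_ sb] st.
  suff : s - p = t by move=> <-; apply/andP; split; lra.
  apply: (embedding_circ_inj ephi); first by rewrite shift.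
  by rewrite ltr_norml; apply/andP; split; lra.
move=> /andP[at_ tb]; split; first by apply/andP; split; lra.
exists (t + p); first by rewrite /= in_itv/=; apply/andP; split; lra.
by rewrite /= -(shift (t + p)) addrK.
Qed.

Lemma arc_measurable Omega phi (a b : R) : lipschitz_immersion Omega phi ->
  measurable ((phi \o @circ R) @` `[a, b]%classic : set plane).
Proof.
move=> iphi; apply: compact_measurable_plane; apply: continuous_compact.
  by apply: continuous_subspaceT; exact: immersion_continuous iphi.
exact: segment_compact.
Qed.

(** All that is kept of the equality of currents. It is symmetric, so one inclusion of images yields
    the other. *)
Definition same_charge phi1 phi2 : Prop := exists v1 v2 w1 w2,
  [/\ line_density phi1 fst (@form1 R) v1 /\ line_density phi1 snd (@form2 R) v2,
      line_density phi2 fst (@form1 R) w1 /\ line_density phi2 snd (@form2 R) w2 &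
      forall A : set plane, measurable A ->
        push_charge mu `[0, 2 * pi]%classic (phi1 \o @circ R) v1 A =
        push_charge mu `[0, 2 * pi]%classic (phi2 \o @circ R) w1 A /\
        push_charge mu `[0, 2 * pi]%classic (phi1 \o @circ R) v2 A =
        push_charge mu `[0, 2 * pi]%classic (phi2 \o @circ R) w2 A].

Lemma same_charge_sym phi1 phi2 : same_charge phi1 phi2 -> same_charge phi2 phi1.
Proof.
move=> [v1 [v2 [w1 [w2 [dv dw e]]]]]; exists w1, w2, v1, v2; split => // A /e[-> ->].
by [].
Qed.

Lemma same_charge_image Omega phi1 phi2 :
  lipschitz_embedding Omega phi1 -> lipschitz_embedding Omega phi2 ->
  same_charge phi1 phi2 -> phi1 @` S1 R `<=` phi2 @` S1 R.
Proof.
move=> e1 e2 [v1 [v2 [w1 [w2 [[dv1 dv2] [dw1 dw2] e]]]]] _ [_ /circ_surj[t <-] <-].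
apply: contrapT => nt.
have c1 := immersion_continuous e1.1.
have c2 : compact (phi2 @` S1 R).
  by apply: continuous_compact; [have [_ [_]] := e2|exact: S1_compact].
have cl2 : closed (phi2 @` S1 R) by apply: compact_closed.
(* The image of [phi2] is closed, so a whole arc of [phi1] around the point avoids it and gets no
   charge from [phi2]. *)
have : \forall s \near t, ~ (phi2 @` S1 R) (phi1 (circ s)).
  have oC := closed_openC cl2.
  exact: (c1 t _ (open_nbhs_nbhs (conj oC nt))).
move=> /nbhs_ballP[d /= d0 dt].
have [k [a [b [ta ab bd ka bk]]]] := @sub_period t (t + d / 2) (ltac:(lra)).
pose A := (phi1 \o @circ R) @` `[a, b]%classic.
have A2 w : push_charge mu `[0, 2 * pi]%classic (phi2 \o @circ R : _ -> plane) w A = 0%E.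
  rewrite /push_charge (_ : _ `&` _ = set0) ?integral_set0// -subset0 => s [_ [r /= rab rs]].
  have : ball t d r.
    move: rab; rewrite in_itv/= => /andP[ar rb].
    by rewrite /ball/= ltr_norml; apply/andP; split; lra.
  by move=> /dt; apply; rewrite rs; exists (circ s) => //; exact: circ_S1.
have [E1 E2] := e A (arc_measurable a b e1.1).
move: E1 E2; rewrite !A2 (arc_charge e1 dv1 ka (ltW ab) bk) (arc_charge e1 dv2 ka (ltW ab) bk).
move=> [/eqP h1] [/eqP h2].
suff : b = a by move=> ba; rewrite ba ltxx in ab.
apply: (embedding_circ_inj e1); last by rewrite gtr0_norm; lra.
move: h1 h2; rewrite !subr_eq0 => /eqP + /eqP.
by case: (phi1 (circ b)) (phi1 (circ a)) => ? ? [? ?] /= -> ->.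
Qed.

(** A decreasing [theta] makes a common arc run in opposite directions; its two charges are then
    opposite displacements, so its end points coincide. *)
Lemma no_reversal Omega phi1 phi2 (theta : R -> R) (a b : R) :
  lipschitz_embedding Omega phi1 -> lipschitz_embedding Omega phi2 ->
  same_charge phi1 phi2 -> continuous theta ->
  (forall t, phi2 (circ t) = phi1 (circ (theta t))) -> a < b ->
  ~ {in `[a, b] &, {homo theta : s t /~ s < t}}.
Proof.
move=> e1 e2 [v1 [v2 [w1 [w2 [[dv1 dv2] [dw1 dw2] e]]]]] cth phiE ab dec.
have [k [a1 [b1 [aa1 ab1 bb1 ka bk]]]] := sub_period ab.
have dec1 s t : a1 <= s -> s < t -> t <= b1 -> theta t < theta s.
  move=> as_ st tb; apply: dec => //; rewrite in_itv/=; apply/andP; split; lra.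
(* A second shrinking, now in the angles of [phi1]: the arc must avoid the base points of both
   parameterizations. *)
have [m [q1 [q2 [bq q12 qa mq qm]]]] := sub_period (dec1 _ _ (lexx _) ab1 (lexx _)).
have ivt q : q1 <= q -> q <= q2 -> exists2 t, a1 <= t <= b1 & theta t = q.
  move=> q1q qq2.
  have hq : Num.min (theta a1) (theta b1) <= q <= Num.max (theta a1) (theta b1).
    by rewrite ge_min le_max (le_trans bq q1q) (le_trans qq2 qa) orbT.
  have := IVT (ltW ab1) (continuous_subspaceT cth) hq. move=> [c cab cq].
  by exists c => //; move: cab; rewrite in_itv.
(* The end points are matched crosswise, [a2] with [q2] and [b2] with [q1], because [theta]
   decreases. *)
have [a2 /andP[a12 a2b] ta2] := ivt q2 (ltW q12) (lexx _).
have [b2 /andP[a1b b2b] tb2] := ivt q1 (lexx _) (ltW q12).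
have ab2 : a2 < b2.
  rewrite ltNge; apply/negP; rewrite le_eqVlt => /predU1P[ba|ba].
    by move: q12; rewrite -ta2 -tb2 ba ltxx.
  by have := dec1 _ _ a1b ba a2b; rewrite ta2 tb2 ltNge (ltW q12).
have AE : (phi2 \o @circ R) @` `[a2, b2]%classic = (phi1 \o @circ R) @` `[q1, q2]%classic.
  apply/seteqP; split => _ [s + <-]; rewrite /= in_itv/= => /andP[s1 s2].
    exists (theta s); last by rewrite phiE.
    rewrite /= in_itv/= -ta2 -tb2.
    have [->|na] := eqVneq s a2; first by rewrite lexx ltW// dec1.
    have [->|nb] := eqVneq s b2; first by rewrite lexx ltW// dec1.
    have ha : a2 < s by rewrite lt_neqAle eq_sym na.
    have hb : s < b2 by rewrite lt_neqAle nb.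
    by apply/andP; split; apply: ltW; apply: dec1 => //; lra.
  have [t /andP[at_ tb] ts] := ivt s s1 s2.
  exists t; last by rewrite phiE ts.
  rewrite /= in_itv/=; apply/andP; split.
    rewrite leNgt; apply/negP => ta.
    by have := dec1 _ _ at_ ta a2b; rewrite ts ta2 ltNge s2.
  rewrite leNgt; apply/negP => ta.
  by have := dec1 _ _ a1b ta tb; rewrite ts tb2 ltNge s1.
pose A := (phi2 \o @circ R) @` `[a2, b2]%classic.
have ka2 : 2 * pi * k%:~R < a2 by lra.
have bk2 : b2 < 2 * pi * k%:~R + 2 * pi by lra.
have [E1 E2] := e A (arc_measurable a2 b2 e2.1).
move: E1 E2; rewrite (arc_charge e2 dw1 ka2 (ltW ab2) bk2).
rewrite (arc_charge e2 dw2 ka2 (ltW ab2) bk2).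
rewrite /A AE (arc_charge e1 dv1 mq (ltW q12) qm) (arc_charge e1 dv2 mq (ltW q12) qm).
(* The displacement from [a2] to [b2] now equals its own opposite in each coordinate. *)
rewrite -ta2 -tb2 -!phiE => -[h1] [h2].
suff : b2 = a2 by move=> ba; rewrite ba ltxx in ab2.
apply: (embedding_circ_inj e2); last by rewrite gtr0_norm; lra.
move: h1 h2; case: (phi2 (circ b2)) (phi2 (circ a2)) => x y [x' y'] /= h1 h2.
by congr pair; lra.
Qed.

End arcs.

(** * Lifting to the universal cover of the circle *)

Section lifting.
Context (R : realType).
Implicit Types (z w : R * R) (s t : R).

Definition dot z w : R := z.1 * w.1 + z.2 * w.2.

(** The signed angle from [w] to [z] for unit vectors with positive [dot]: the quotient is its sine
    over its cosine. *)
Definition angle w z : R := atan ((z.2 * w.1 - z.1 * w.2) / dot z w).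

(** [D] and [C] satisfy [D ^+ 2 + C ^+ 2 = 1]; as [D] is positive, they are the cosine and sine of
    [atan (C / D)]. The addition formulas then rotate [w] onto [z]. *)
Lemma circ_add_angle (c : R) z : S1 R z -> 0 < dot z (circ c) ->
  circ (c + angle (circ c) z) = z.
Proof.
case: z => x y; rewrite /angle; set w := circ c; rewrite /S1 /dot /= => xy d0.
have w1 : w.1 ^+ 2 + w.2 ^+ 2 = 1 by exact: circ_S1.
set D := x * w.1 + y * w.2 in d0 *; set C := y * w.1 - x * w.2.
have DC : D ^+ 2 + C ^+ 2 = 1.
  have -> : D ^+ 2 + C ^+ 2 = (x ^+ 2 + y ^+ 2) * (w.1 ^+ 2 + w.2 ^+ 2).
    by rewrite /D /C; ring.
  by rewrite xy w1 mulr1.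
have D0 : D != 0 by rewrite gt_eqF.
have ca : cos (atan (C / D)) = D.
  rewrite cos_atan.
  have -> : 1 + (C / D) ^+ 2 = (D^-1) ^+ 2.
    by rewrite -[X in X + _](divff (expf_neq0 2 D0)) expr_div_n -mulrDl DC mul1r exprVn.
  by rewrite sqrtr_sqr gtr0_norm ?invr_gt0// invrK.
have sa : sin (atan (C / D)) = C.
  have := @atanK R (C / D); rewrite /tan ca => /(congr1 (fun u => u * D)).
  by rewrite !divfK.
rewrite /circ cosD sinD ca sa -/(circ c).1 -[cos c]/(w.1) -[sin c]/(w.2).
congr pair; rewrite /C /D.
  by rewrite -[RHS]mulr1 -w1; ring.
by rewrite -[RHS]mulr1 -w1; ring.
Qed.

Lemma angle_id w : angle w w = 0.
Proof. by rewrite /angle (mulrC w.2) subrr mul0r atan0. Qed.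

(** For unit vectors [dot z w] is 1 minus half the squared Euclidean distance, and that square is
    below 2 when the maximum norm of the difference is below 1. *)
Lemma dot_gt0 z w : S1 R z -> S1 R w -> `|z - w| < 1 -> 0 < dot z w.
Proof.
case: z w => x y [x' y']; rewrite /S1 /dot prod_normE/= gt_max !ltr_norml.
by move=> h1 h2 /andP[/andP[? ?] /andP[? ?]]; nra.
Qed.

Lemma min_max_continuous (a b : R) : continuous (fun t => Num.min (Num.max t a) b).
Proof.
move=> t; apply: (@continuous_min _ _ (fun t => Num.max t a) (fun=> b)).
  apply: (@continuous_max _ _ id (fun=> a)); first exact: cvg_id.
  exact: cvg_cst.
exact: cvg_cst.
Qed.

Lemma clamp_bound (a b t : R) : a <= b -> a <= Num.min (Num.max t a) b <= b.
Proof. by move=> ab; rewrite le_min le_max lexx orbT ab /= ge_min lexx orbT. Qed.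

Lemma clamp_id (a b t : R) : a <= t <= b -> Num.min (Num.max t a) b = t.
Proof. by move=> /andP[ta tb]; rewrite max_l// min_l. Qed.

Lemma clamp_le (a b t : R) : a <= b -> t <= a -> Num.min (Num.max t a) b = a.
Proof. by move=> ab ta; rewrite max_r// min_l. Qed.

Lemma clamp_ge (a b t : R) : a <= b -> b <= t -> Num.min (Num.max t a) b = b.
Proof. by move=> ab bt; rewrite min_r// le_max bt. Qed.

(** Recursive, so that the end of the next cell unfolds to [grid d n + d]. *)
Fixpoint grid (d : R) (n : nat) : R := if n is m.+1 then grid d m + d else 0.

Lemma gridE (d : R) (n : nat) : grid d n = n%:R * d.
Proof. by elim: n => [|n /= ->]; rewrite ?mul0r// -natr1 mulrDl mul1r. Qed.

Lemma grid_ge0 (d : R) (n : nat) : 0 < d -> 0 <= grid d n.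
Proof. by move=> d0; rewrite gridE mulr_ge0// ltW. Qed.

Definition grid_up (d : R) (n : nat) (t : R) : R :=
  Num.min (Num.max t (grid d n)) (grid d n + d).

Definition grid_down (d : R) (n : nat) (t : R) : R :=
  Num.min (Num.max t (- (grid d n + d))) (- grid d n).

(* A lift of f on [- n d, n d], extended by constants. *)
Fixpoint partial_lift (f : R -> R * R) (d c : R) (n : nat) (t : R) : R :=
  if n is m.+1 then
    partial_lift f d c m t + angle (f (grid d m)) (f (grid_up d m t))
      + angle (f (- grid d m)) (f (grid_down d m t))
  else c.

(** As [g] stays within [d] of [u], the denominator [dot] remains positive. *)
Lemma angle_continuous (f : R -> R * R) (g : R -> R) (u d : R) :
  continuous f -> (forall t, S1 R (f t)) ->
  (forall s t, `|s - t| <= d -> `|f s - f t| < 1) ->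
  continuous g -> (forall t, `|g t - u| <= d) ->
  continuous (fun t => angle (f u) (f (g t))).
Proof.
move=> cf fS1 fd cg gu t; rewrite /angle.
have c1 : {for t, continuous (fun t => (f (g t)).1)}.
  apply: (continuous_comp (g := fun s => (f s).1)); first exact: cg.
  by apply: continuous_comp; [exact: cf|exact: cvg_fst].
have c2 : {for t, continuous (fun t => (f (g t)).2)}.
  apply: (continuous_comp (g := fun s => (f s).2)); first exact: cg.
  by apply: continuous_comp; [exact: cf|exact: cvg_snd].
apply: continuous_comp; last exact: continuous_atan.
apply: cvgM.
  by apply: cvgB; apply: cvgM => //; exact: cvg_cst.
apply: cvgV; first by rewrite gt_eqF// dot_gt0//; exact: fd.
by apply: cvgD; apply: cvgM => //; exact: cvg_cst.
Qed.

Lemma partial_lift_continuous (f : R -> R * R) (d c : R) (n : nat) : 0 < d ->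
  continuous f -> (forall t, S1 R (f t)) ->
  (forall s t, `|s - t| <= d -> `|f s - f t| < 1) ->
  continuous (partial_lift f d c n).
Proof.
move=> d0 cf fS1 fd; elim: n => [|n IH]; first by move=> t; exact: cvg_cst.
move=> t; apply: cvgD; first apply: cvgD.
- exact: IH.
- apply: (@angle_continuous _ (grid_up d n)) fd _ _ _ => //.
    exact: min_max_continuous.
  move=> s; have le : grid d n <= grid d n + d by lra.
  have /andP[] := clamp_bound s le.
  rewrite -/(grid_up d n s) ler_norml => ? ?.
  by apply/andP; split; lra.
- apply: (@angle_continuous _ (grid_down d n)) fd _ _ _ => //.
    exact: min_max_continuous.
  move=> s; have le : - (grid d n + d) <= - grid d n by lra.
  have /andP[] := clamp_bound s le.
  rewrite -/(grid_down d n s) ler_norml => ? ?.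
  by apply/andP; split; lra.
Qed.

(** Inside the earlier range both clamped points sit at the inner ends of the new cells, where the
    added angles vanish. *)
Lemma partial_lift_stable f (d c : R) n t : 0 < d -> `|t| <= grid d n ->
  partial_lift f d c n.+1 t = partial_lift f d c n t.
Proof.
move=> d0; have n0 := grid_ge0 n d0.
rewrite ler_norml => /andP[t1 t2] /=.
rewrite /grid_up (@clamp_le _ _ t)//; last by lra.
rewrite /grid_down (@clamp_ge _ _ t)//; last by lra.
by rewrite !angle_id !addr0.
Qed.

Lemma partial_lift_ge f (d c : R) n t : 0 < d -> grid d n <= t ->
  partial_lift f d c n t = partial_lift f d c n (grid d n).
Proof.
move=> d0; elim: n t => [//|n IH] t.
have n0 := grid_ge0 n d0; move=> /= nt.
rewrite (IH t); last by lra.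
rewrite (IH (grid d n + d)); last by lra.
rewrite /grid_up /grid_down !(@clamp_ge (grid d n)); try lra.
by rewrite !(@clamp_ge (- (grid d n + d)) (- grid d n)); try lra.
Qed.

Lemma partial_lift_le f (d c : R) n t : 0 < d -> t <= - grid d n ->
  partial_lift f d c n t = partial_lift f d c n (- grid d n).
Proof.
move=> d0; elim: n t => [//|n IH] t.
have n0 := grid_ge0 n d0; move=> /= nt.
rewrite (IH t); last by lra.
rewrite (IH (- (grid d n + d))); last by lra.
rewrite /grid_up /grid_down !(@clamp_le (grid d n)); try lra.
by rewrite !(@clamp_le (- (grid d n + d)) (- grid d n)); try lra.
Qed.

(** In a new cell the lift is its value at the inner end plus the small angle from there to [f t];
    the cell on the other side adds nothing. *)
Lemma circ_partial_lift (f : R -> R * R) (d c : R) (n : nat) (t : R) : 0 < d ->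
  (forall t, S1 R (f t)) -> (forall s t, `|s - t| <= d -> `|f s - f t| < 1) ->
  f 0 = circ c -> `|t| <= grid d n -> circ (partial_lift f d c n t) = f t.
Proof.
move=> d0 fS1 fd fc; elim: n t => [|n IH] t.
  by rewrite normr_le0 => /eqP ->; rewrite fc.
have [tn|tn] := leP `|t| (grid d n); first by rewrite partial_lift_stable// IH.
have n0 := grid_ge0 n d0; move=> /= tn1.
have [t0|t0] := leP 0 t.
  rewrite (ger0_norm t0) in tn tn1.
  rewrite (partial_lift_ge _ _ d0 (ltW tn)) /grid_up /grid_down.
  rewrite clamp_id; last by apply/andP; split; lra.
  rewrite clamp_ge; [|lra|lra].
  rewrite angle_id addr0.
  have e : circ (partial_lift f d c n (grid d n)) = f (grid d n).
    by rewrite IH// ger0_norm.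
  rewrite -e circ_add_angle// e dot_gt0//; apply: fd.
  by rewrite ler_norml; apply/andP; split; lra.
rewrite (ltr0_norm t0) in tn tn1.
have tn' : t <= - grid d n by lra.
rewrite (partial_lift_le _ _ d0 tn') /grid_up /grid_down.
rewrite clamp_le; [|lra|lra].
rewrite angle_id addr0 clamp_id; last by apply/andP; split; lra.
have e : circ (partial_lift f d c n (- grid d n)) = f (- grid d n).
  by rewrite IH// normrN ger0_norm.
rewrite -e circ_add_angle// e dot_gt0//; apply: fd.
by rewrite ler_norml; apply/andP; split; lra.
Qed.

Lemma partial_lift_eq f (d c : R) m n t : 0 < d -> `|t| <= grid d m -> (m <= n)%N ->
  partial_lift f d c n t = partial_lift f d c m t.
Proof.
move=> d0 tm /subnK <-; elim: (n - m)%N => [//|k IH].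
rewrite addSn partial_lift_stable ?IH//; apply: (le_trans tm).
by rewrite !gridE ler_wpM2r ?(ltW d0)// ler_nat leq_addl.
Qed.

(** All partial lifts whose range contains [t] agree there, so their common value defines
    [theta]. *)
Lemma circ_lift (f : R -> R * R) (d : R) : 0 < d ->
  continuous f -> (forall t, S1 R (f t)) ->
  (forall s t, `|s - t| <= d -> `|f s - f t| < 1) ->
  exists2 theta : R -> R, continuous theta & forall t, f t = circ (theta t).
Proof.
move=> d0 cf fS1 fd; have [c fc] := circ_surj (fS1 0).
have bound t : exists n : nat, `|t| <= grid d n.
  exists (Num.truncn (`|t| / d)).+1.
  by rewrite gridE -ler_pdivrMr// ltW// truncnS_gt.
pose N t := sval (cid (bound t)).
have NP t : `|t| <= grid d (N t) by rewrite /N; case: cid.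
pose theta t := partial_lift f d c (N t) t.
have thetaE n t : `|t| <= grid d n -> theta t = partial_lift f d c n t.
  move=> tn; rewrite /theta; have [nN|Nn] := leqP n (N t).
    exact: partial_lift_eq.
  by apply/esym/partial_lift_eq => //; exact: ltnW.
exists theta; last by move=> t; rewrite /theta circ_partial_lift.
(* The margin 1 lets a single partial lift represent [theta] on a whole neighbourhood of [t]. *)
move=> t; have [n tn] := bound (`|t| + 1).
have e : {near t, partial_lift f d c n =1 theta}.
  near=> s; rewrite (thetaE n)//.
  have st : `|t - s| < 1.
    by near: s; apply: cvgr_dist_lt => //; exact: cvg_id.
  apply: le_trans tn; rewrite [leRHS]ger0_norm ?addr_ge0//.
  have -> : s = t - (t - s) by ring.
  by apply: (le_trans (ler_normB _ _)); rewrite lerD2l ltW.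
rewrite /continuous_at (thetaE n); last first.
  by apply: le_trans tn; rewrite [leRHS]ger0_norm ?addr_ge0// lerDl.
have pc := @partial_lift_continuous f d c n d0 cf fS1 fd t.
by apply: cvg_trans; [exact: (near_eq_cvg e)|exact: pc].
Unshelve. all: by end_near. Qed.

End lifting.

(** * The reparameterization and its orientation *)

Lemma within_continuous_within_comp (T U V : topologicalType) (A : set T) (B : set U)
    (f : T -> U) (g : U -> V) :
  {within A, continuous f} -> f @` A `<=` B -> {within B, continuous g} ->
  {within A, continuous (g \o f)}.
Proof.
move=> /subspace_continuousP cf fAB /subspace_continuousP cg.
apply/subspace_continuousP => x Ax W gW.
have fxB : B (f x) by apply: fAB; exists x.
have h : nbhs x (fun y => A y -> B (f y) -> W (g (f y))) := cf x Ax _ (cg _ fxB W gW).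
suff : nbhs x (fun y => A y -> W (g (f y))) by [].
apply: filterS h => y h Ay; apply: (h Ay).
by apply: fAB; exists y.
Qed.

(** Compactness of one period gives a uniform [d] for [s] in it and any real [t]; a common
    translation of [s] and [t] does the rest. *)
Lemma periodic_unif_continuous (R : realType) (f : R -> R * R) (p : R) : 0 < p ->
  continuous f -> (forall t (k : int), f (t + p * k%:~R) = f t) ->
  exists2 d, 0 < d & forall s t, `|s - t| <= d -> `|f s - f t| < 1.
Proof.
move=> p0 cf fp.
have /compact_near_coveringP/(_ _ (0 : R)^'+
  (fun d x => forall t, `|x - t| <= d -> `|f x - f t| < 1)) :=
  @segment_compact R 0 p.
move=> /(_ _ _)[].
- move=> x _.
  have /nbhs_ballP[e /= e0 xe] : \forall t \near x, `|f x - f t| < 1 / 2.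
    by have /cvgrPdist_lt := cf x; apply; rewrite divr_gt0.
  exists (ball x (e / 2), [set d | d < e / 2]).
    split => /=; first by apply: nbhsx_ballx; rewrite divr_gt0.
    by apply: nbhs_right_lt; rewrite divr_gt0.
  move=> [y d] [/= xy de] t yt.
  have xt : ball x e t.
    rewrite /ball/= in xy *; have -> : x - t = (x - y) + (y - t) by ring.
    by apply: (le_lt_trans (ler_normD _ _)); lra.
  have yx : ball x e y by rewrite /ball/= in xy *; lra.
  have h1 := xe _ xt; have h2 := xe _ yx.
  have -> : f y - f t = (f x - f t) - (f x - f y) by rewrite opprB [RHS]addrC subrKA.
  by apply: (le_lt_trans (ler_normB _ _)); lra.
move=> e /= e0 H; exists (e / 2); first by rewrite divr_gt0.
move=> s t st.
have [k /andP[k0 k1]] := modulo_period s p0.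
have {}H := H (e / 2) _ _ (s - p * k%:~R).
rewrite -(fp s (- k)) -(fp t (- k)) !mulrNz !mulrN; apply: H.
- by rewrite /= sub0r normrN gtr0_norm; lra.
- lra.
- by rewrite /= in_itv/= k0 ltW.
- by rewrite opprB addrA subrK.
Qed.

(** Longer intervals are crossed in steps of [p / 2], by induction on their number. *)
Lemma increasing_of_local (R : realType) (theta : R -> R) (p : R) : 0 < p ->
  (forall a b, a < b -> b - a < p -> theta a < theta b) ->
  {homo theta : s t / s < t}.
Proof.
move=> p0 H.
have P (n : nat) a b : a < b -> b - a < n%:R * (p / 2) -> theta a < theta b.
  elim: n a b => [|n IH] a b ab; first by rewrite mul0r subr_lt0 ltNge ltW.
  rewrite -natr1 mulrDl mul1r => bn.
  have [bp|bp] := ltP (b - a) p; first exact: H.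
  apply: (@lt_trans _ _ (theta (a + p / 2))); first by apply: H; lra.
  by apply: IH; lra.
move=> a b ab; apply: (P (Num.truncn ((b - a) / (p / 2))).+1) => //.
by rewrite -ltr_pdivrMr ?divr_gt0// truncnS_gt.
Qed.

Theorem proposition5 (R : realType) (Omega : set (R * R)) (sigma : R)
    (phi1 phi2 : R * R -> R * R)
    (hOmega : domain Omega) (hsigma : 0 < sigma)
    (hphi1 : lipschitz_embedding Omega phi1)
    (hphi2 : lipschitz_embedding Omega phi2)
    (hcurrent : Hm1Lambda1_eq Omega (current sigma Omega phi1)
                                    (current sigma Omega phi2)) :
  same_oriented_shape phi1 phi2.
Proof.
have pi2 : 0 < 2 * pi :> R by rewrite mulr_gt0// pi_gt0.
have oO : open Omega by case: hOmega.
have sc : same_charge phi1 phi2.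
  have [v1 [v2 [dv1 dv2]]] := immersion_density hphi1.1.
  have [w1 [w2 [dw1 dw2]]] := immersion_density hphi2.1.
  exists v1, v2, w1, w2; split => // A mA; split.
    exact: (push_charge_current hphi1.1 hphi2.1 hcurrent (form1_H1_tensor oO) dv1 dw1 mA).
  exact: (push_charge_current hphi1.1 hphi2.1 hcurrent (form2_H1_tensor oO) dv2 dw2 mA).
have C12 := same_charge_image hphi1 hphi2 sc.
have C21 := same_charge_image hphi2 hphi1 (same_charge_sym sc).
have [_ [[_ inj1 _] c1 [g1 [g1K cg1]]]] := hphi1.
have [_ [[_ inj2 _] c2 [g2 [g2K cg2]]]] := hphi2.
(* The images coincide, so [phi2] can be followed by the inverse of [phi1]. *)
pose psi := g1 \o phi2.
have psiE z : S1 R z -> S1 R (psi z) /\ phi1 (psi z) = phi2 z.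
  move=> Sz; have [w Sw wz] : (phi1 @` S1 R) (phi2 z) by apply: C21; exists z.
  by rewrite /psi /= -wz g1K.
have cpsi : {within S1 R, continuous psi} by exact: within_continuous_within_comp c2 C21 cg1.
have hpsi : homeomorphism (S1 R) (S1 R) psi.
  split => //.
    split.
    - by move=> z /psiE[].
    - move=> x y xS yS e; apply: inj2 => //.
      by rewrite -(psiE x (set_mem xS)).2 -(psiE y (set_mem yS)).2 e.
    - move=> z Sz; have [w Sw wz] : (phi2 @` S1 R) (phi1 z) by apply: C12; exists z.
      by exists w => //; rewrite /psi /= wz g1K.
  exists (g2 \o phi1); split; last exact: within_continuous_within_comp c1 C12 cg2.
  by move=> z Sz; rewrite /= (psiE z Sz).2 g2K.
exists psi; last by move=> z /psiE[].
split => //.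
pose f := psi \o @circ R.
have fS1 t : S1 R (f t) by have [] := psiE _ (circ_S1 t).
have cf : continuous f.
  apply/continuous_subspace_setT; apply: (within_continuous_within_comp _ _ cpsi).
    by apply: continuous_subspaceT; exact: circ_continuous.
  by move=> _ [t _ <-]; exact: circ_S1.
have fper t (k : int) : f (t + 2 * pi * k%:~R) = f t by rewrite /f /= circ_periodic.
have [d d0 fd] := periodic_unif_continuous pi2 cf fper.
have [theta cth fE] := circ_lift d0 cf fS1 fd.
have phiE t : phi2 (circ t) = phi1 (circ (theta t)).
  by rewrite -fE (psiE _ (circ_S1 t)).2.
exists theta; split => //.
(* On less than one period [phi2] is injective in the angle, hence so is [theta]. *)
apply: (increasing_of_local pi2) => a b ab ba.
have inj : {in `[a, b] &, injective theta}.
  move=> s t; rewrite !in_itv/= => /andP[as_ sb] /andP[at_ tb] st.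
  apply: (embedding_circ_inj hphi2); first by rewrite !phiE st.
  by rewrite ltr_norml; apply/andP; split; lra.
have cw : {within `[a, b], continuous theta} by exact: continuous_subspaceT.
rewrite ltNge; apply/negP => ge.
apply: (no_reversal hphi1 hphi2 sc cth phiE ab).
(* A continuous injective function on a segment is strictly monotone, so failing to increase it
   would decrease. *)
have mono := segment_continuous_inj_ge ge cw inj.
by move=> s t sI tI st; rewrite (leW_nmono_in mono).
Qed.
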